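(* Let $\mathcal H$ be a separable complex Hilbert space and let $w\colon\mathbb N_0\to\mathbb R_{>0}$ be a weight with $w(0)=1$, such that $w^{-1}\in\ell^2(\mathbb N_0)$ is strictly positive and $w^{-2}$ is subconvolutive, $w^{-2}*w^{-2}\le C\,w^{-2}$ for some constant $C$. Let $F_w^\otimes(\mathcal H)$ and $F_w(\mathcal H)$ be the weighted full and symmetric Fock spaces of $\mathcal H$, respectively. Then there are isomorphisms, as Hilbert spaces and as Banach algebras, $$F_w^\otimes(\mathcal H)\Big/\bigcap_{\chi\in\sigma(F_w^\otimes(\mathcal H))}\ker(\chi)\ \cong\ \overline{\operatorname{span}\left\{\sum_{n=0}^\infty w^{-2}(n)\,\eta^{\otimes n}:\ \eta\in(\mathcal H)_{R_w}\right\}}\ \cong\ F_w(\mathcal H).$$ Moreover, $F_w^\otimes(\mathcal H)$ and $F_w(\mathcal H)$ have the same spectra as Banach algebras.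
   Context: Inner products are conjugate-linear in the first argument. $F_w^\otimes(\mathcal H)$ is the Hilbert space completion of the tensor algebra $\mathbb C\oplus\mathcal H\oplus\mathcal H^{\otimes2}\oplus\cdots$ with respect to the inner product for which different degrees are orthogonal, $\langle a,b\rangle=\bar ab$ for $a,b\in\mathbb C$, and $\langle f_1\otimes\cdots\otimes f_n,g_1\otimes\cdots\otimes g_n\rangle=w^2(n)\prod_{i=1}^n\langle f_i,g_i\rangle_{\mathcal H}$. Under the hypotheses on $w$, the product $\otimes$ is bounded and $F_w^\otimes(\mathcal H)$ is a unital Banach algebra with unit $\Omega=1\in\mathbb C$ for the norm $|||f|||=\sup_{h\ne0}\lVert f\otimes h\rVert/\lVert h\rVert$, equivalent to the Hilbert space norm. $F_w(\mathcal H)\subseteq F_w^\otimes(\mathcal H)$ is the closed subspace spanned by symmetric tensors, $\mathrm{Sym}\colon F_w^\otimes(\mathcal H)\to F_w(\mathcal H)$ is the orthogonal projection onto it (given by averaging tensors over permutations), and $F_w(\mathcal H)$ carries the symmetric tensor product $f\vee g=\mathrm{Sym}(f\otimes g)$. The middle space (closure in $F_w^\otimes(\mathcal H)$) carries the product $(f,g)\mapsto\mathrm{Sym}(f\otimes g)$, and the quotient carries the quotient Hilbert space and quotient algebra structures. Banach algebra isomorphism means algebra isomorphism that is bounded with bounded inverse (the Banach algebra norms involved are equivalent to the Hilbert space norms). $R_w$ is the radius of convergence of $\sum_{n=0}^\infty w^{-2}(n)z^{2n}$, and $(\mathcal H)_{R_w}$ is the closed ball of radius $R_w$ in $\mathcal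 H$. The spectrum $\sigma(A)$ of a Banach algebra $A$ is the set of nonzero multiplicative linear functionals $A\to\mathbb C$. ''Same spectra'' is understood by identifying bounded functionals with their representing vectors: the set of $\xi\in F_w(\mathcal H)$ with $\langle\xi,\cdot\rangle_{F_w(\mathcal H)}\in\sigma(F_w(\mathcal H))$ equals the set of $\xi\in F_w^\otimes(\mathcal H)$ with $\langle\xi,\cdot\rangle_{F_w^\otimes(\mathcal H)}\in\sigma(F_w^\otimes(\mathcal H))$. Convolution on $\mathbb N_0$: $(u*v)(n)=\sum_{a+b=n}u(a)v(b)$. *)

(* Defs.v *)
From HB Require Import structures.
From mathcomp Require Import all_boot all_order all_algebra perm.
From mathcomp Require Import complex.
From mathcomp Require Import all_classical all_reals all_analysis.

Set Implicit Arguments.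
Unset Strict Implicit.
Unset Printing Implicit Defensive.

Import Order.TTheory GRing.Theory Num.Theory.
Import numFieldNormedType.Exports.

Local Open Scope classical_set_scope.
Local Open Scope ring_scope.
Local Open Scope complex_scope.

(* The inner product is linear in its second argument, hence conjugate-linear
   in the first one; this is the opposite of the convention of the forms
   {dot _ for _} of sesquilinear.v. *)
HB.mixin Record isHilbert (R : realType) H of CompleteNormedModule R[i] H := {
  hdot : H -> H -> R[i];
  hdotC : forall x y : H, hdot x y = (hdot y x)^*;
  hdotDr : forall x y z : H, hdot x (y + z) = hdot x y + hdot x z;
  hdotZr : forall (a : R[i]) (x y : H), hdot x (a *: y) = a * hdot x y;
  hdotxx : forall x : H, hdot x x = `|x| ^+ 2
}.

#[short(type="hilbertType")]
HB.structure Definition Hilbert (R : realType) :=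
  {H of CompleteNormedModule R[i] H & isHilbert R H}.

Definition separable (T : topologicalType) : Prop :=
  exists A : set T, countable A /\ dense A.

(* Norms of normed spaces over R[i] take their values in R[i]. *)
Definition hnorm (R : realType) (H : hilbertType R) (x : H) : R := complex.Re `|x|.

Definition lspan (K : pzRingType) (V : lmodType K) (A : set V) : set V :=
  [set x | exists (n : nat) (c : 'I_n -> K) (a : 'I_n -> V),
     (forall i, A (a i)) /\ x = \sum_(i < n) c i *: a i].

Definition closed_span (R : realType) (H : hilbertType R) (A : set H) : set H :=
  closure (lspan A).

(* For a closed subspace S, the point chosen here exists and is unique. *)
Definition orth_proj (R : realType) (H : hilbertType R) (S : set H) (f : H) : H :=
  xget 0 [set p | S p /\ forall g, S g -> hdot g (f - p) = 0].

Definition square_summable (R : realType) (u : nat -> R) : Prop :=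
  cvgn (series (fun n => u n ^+ 2)).

Definition convolution (R : realType) (u v : nat -> R) (n : nat) : R :=
  \sum_(k < n.+1) u k * v (n - k)%N.

Definition subconvolutive (R : realType) (u : nat -> R) : Prop :=
  exists C : R, forall n, convolution u u n <= C * u n.

(* The radius of convergence of the power series \sum_n (w n)^-2 z^(2n): since
   the coefficients are nonnegative, it suffices to consider z = r >= 0. *)
Definition weight_radius (R : realType) (w : nat -> R) : \bar R :=
  ereal_sup [set r%:E | r in
    [set r : R | 0 <= r /\ cvgn (series (fun n => w n ^- 2 * r ^+ (2 * n)))]].

(* A Hilbert space completion of the tensor algebra of H for the inner product
   weighted by w. A linear map on the tensor algebra amounts to a family of
   multilinear maps on H ^ n, n >= 0, here gathered into a single function on
   finite sequences: tens [:: f_1; ..; f_n] is f_1 (x) .. (x) f_n, and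
   tens [::] is the unit 1 of the degree 0 component. By dot_tens this linear
   map is isometric and by tens_dense its range is dense, so that fock_space is
   determined up to a unique unitary map compatible with tens. *)
Record fock_space (R : realType) (H : hilbertType R) (w : nat -> R) :=
  FockSpace {
  fock_sort :> hilbertType R;
  tens : seq H -> fock_sort;
  tens_linear : forall (u v : seq H) (a : R[i]) (x y : H),
    tens (u ++ (a *: x + y) :: v)
    = a *: tens (u ++ x :: v) + tens (u ++ y :: v);
  dot_tens : forall u v : seq H,
    hdot (tens u) (tens v) =
      if size u == size v
      then (w (size u) ^+ 2)%:C * \prod_(p <- zip u v) hdot p.1 p.2
      else 0;
  tens_dense : closed_span (range tens) = [set: fock_sort]
}.

Section Fock.
Variables (R : realType) (H : hilbertType R) (w : nat -> R).
Variable F : fock_space H w.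

Definition fock_unit : F := tens F [::].

(* m is the continuous bilinear extension of the product of the tensor algebra;
   there is at most one. *)
Definition is_tensor_product (m : F -> F -> F) : Prop :=
  [/\ forall (a : R[i]) f f' g, m (a *: f + f') g = a *: m f g + m f' g,
      forall (a : R[i]) f g g', m f (a *: g + g') = a *: m f g + m f g',
      exists M : R, forall f g, hnorm (m f g) <= M * hnorm f * hnorm g &
      forall u v : seq H, m (tens F u) (tens F v) = tens F (u ++ v)].

(* Meaningful when the product of the tensor algebra is bounded, i.e. when some
   m satisfies is_tensor_product; otherwise this is the zero map. *)
Definition ftens : F -> F -> F :=
  xget (fun _ _ => 0) [set m | is_tensor_product m].

(* The average of f_1 (x) .. (x) f_n over all permutations of its factors. *)
Definition symtens (u : seq H) : F :=
  ((size u)`!%:R)^-1 *: \sum_(s : {perm 'I_(size u)})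
    tens F [seq tnth (in_tuple u) (s i) | i <- enum 'I_(size u)].

Definition sym_fock : set F := closed_span (range symtens).

Definition sym_proj : F -> F := orth_proj sym_fock.

Definition kernel_vector (eta : H) : F :=
  limn (series (fun n => (w n ^- 2)%:C *: tens F (nseq n eta))).

Definition kernel_vectors : set F :=
  [set kernel_vector eta | eta in
     [set eta : H | ((hnorm eta)%:E <= weight_radius w)%E]].

Definition kernel_space : set F := closed_span kernel_vectors.

End Fock.
Arguments fock_unit {R H w} F.
Arguments ftens {R H w} F _ _.
Arguments symtens {R H w} F _.
Arguments sym_fock {R H w} F _.
Arguments sym_proj {R H w} F _.
Arguments kernel_vector {R H w} F _.
Arguments kernel_vectors {R H w} F _.
Arguments kernel_space {R H w} F _.

(* The operations and the Hilbert space norm of a unital algebra with carrier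
   the subset ha_dom of ha_sort; the operations are relevant only on ha_dom. *)
Record hilbert_algebra (R : realType) := HilbertAlgebra {
  ha_sort : Type;
  ha_dom : set ha_sort;
  ha_add : ha_sort -> ha_sort -> ha_sort;
  ha_scale : R[i] -> ha_sort -> ha_sort;
  ha_mul : ha_sort -> ha_sort -> ha_sort;
  ha_one : ha_sort;
  ha_norm : ha_sort -> R
}.

Section HilbertAlgebras.
Variable R : realType.
Implicit Types A B : hilbert_algebra R.

Definition mul_closed A : Prop :=
  ha_dom (ha_one A) /\
  forall x y : ha_sort A, ha_dom x -> ha_dom y -> ha_dom (ha_mul x y).

Definition linear_iso A B (phi : ha_sort A -> ha_sort B) : Prop :=
  [/\ set_bij (@ha_dom R A) (@ha_dom R B) phi,
      forall x y, ha_dom x -> ha_dom y ->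
        phi (ha_add x y) = ha_add (phi x) (phi y) &
      forall a x, ha_dom x -> phi (ha_scale a x) = ha_scale a (phi x)].

(* By polarization, a linear bijection preserves the norm if and only if it
   preserves the inner product. *)
Definition hilbert_iso A B (phi : ha_sort A -> ha_sort B) : Prop :=
  linear_iso phi /\ forall x, ha_dom x -> ha_norm (phi x) = ha_norm x.

(* Boundedness is expressed with the Hilbert space norms, to which the Banach
   algebra norms are equivalent. *)
Definition banach_algebra_iso A B (phi : ha_sort A -> ha_sort B) : Prop :=
  [/\ mul_closed A, mul_closed B, linear_iso phi,
      (forall x y, ha_dom x -> ha_dom y ->
         phi (ha_mul x y) = ha_mul (phi x) (phi y))
      /\ phi (ha_one A) = ha_one B &
      exists M : R, forall x, ha_dom x ->
        ha_norm (phi x) <= M * ha_norm x /\ ha_norm x <= M * ha_norm (phi x)].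

Definition isomorphic A B : Prop :=
  exists phi : ha_sort A -> ha_sort B, hilbert_iso phi /\ banach_algebra_iso phi.

(* The values of chi outside ha_dom are irrelevant. *)
Definition spectrum A : set (ha_sort A -> R[i]) :=
  [set chi | [/\ forall x y, ha_dom x -> ha_dom y ->
                   chi (ha_add x y) = chi x + chi y,
                 forall a x, ha_dom x -> chi (ha_scale a x) = a * chi x,
                 forall x y, ha_dom x -> ha_dom y ->
                   chi (ha_mul x y) = chi x * chi y &
                 exists2 x, ha_dom x & chi x != 0]].

End HilbertAlgebras.
Arguments spectrum {R} A _.

Section FockAlgebras.
Variables (R : realType) (H : hilbertType R) (w : nat -> R).
Variable F : fock_space H w.

Definition full_algebra : hilbert_algebra R :=
  @HilbertAlgebra R F setT +%R *:%R (ftens F) (fock_unit F) (@hnorm R F).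

Definition sym_algebra (S : set F) : hilbert_algebra R :=
  @HilbertAlgebra R F S +%R *:%R (fun f g => sym_proj F (ftens F f g)) (fock_unit F)
    (@hnorm R F).

Definition coset (J : set F) (f : F) : set F := [set f + j | j in J].

(* Elements of F / J are cosets, and the norm is the distance to J. *)
Definition quotient_algebra (J : set F) : hilbert_algebra R :=
  @HilbertAlgebra R (set F) (range (coset J))
    (fun A B => [set a + b | a in A & b in B])
    (fun c A => [set c *: a + j | a in A & j in J])
    (fun A B => [set ftens F ab.1 ab.2 + j | ab in A `*` B & j in J])
    (coset J (fock_unit F))
    (fun A => inf [set hnorm a | a in A]).

Definition spectral_radical : set F :=
  \bigcap_(chi in spectrum full_algebra) [set f | chi f = 0].

End FockAlgebras.
Arguments full_algebra {R H w} F.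
Arguments spectral_radical {R H w} F _.

(* Main.v *)
Require Import Defs.
From HB Require Import structures.
From mathcomp Require Import all_boot all_order all_algebra perm.
From mathcomp Require Import complex.
From mathcomp Require Import all_classical all_reals all_analysis.
From mathcomp Require Import ring lra.

(* Put u = w^-2. A tensor of bidegree (j, k) satisfies
   |f (x) g| = w(j+k) w(j)^-1 w(k)^-1 |f||g|, so that the Cauchy-Schwarz inequality
   in each total degree and u * u <= C u give |f (x) g|^2 <= C |f|^2 |g|^2.
   A character chi is bounded (chi f = 1 with |f| small is impossible, because
   g = f + f (x) g would then have a solution), so chi restricts to <eta, .> on H and
   chi (x_1 (x) .. (x) x_n) = prod_i <eta, x_i>. Testing chi on the partial sums of
   the kernel vector kappa_eta bounds sum_n u(n) |eta|^2n, hence |eta| <= R_w and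
   chi = <kappa_eta, .>; conversely S^2 <= C S for S = sum_n u(n) r^2n, r < R_w,
   bounds S by C up to and including r = R_w, so every eta in the closed ball gives
   a character. The joint kernel J of the characters is thus the orthogonal complement
   of the span K of the kernel vectors. Differentiating t |-> kappa_(t eta) at 0 yields
   eta^(x)n in K, and polarization gives K = F_w(H). Since J is an ideal, the
   orthogonal projection onto K induces the isomorphism of the quotient by J with K,
   and a functional represented in K is multiplicative on F iff it is so on K. *)

Set Implicit Arguments.
Unset Strict Implicit.
Unset Printing Implicit Defensive.
Import Order.TTheory GRing.Theory Num.Theory.
Import numFieldNormedType.Exports.
Local Open Scope classical_set_scope.
Local Open Scope ring_scope.

(** * Real-valued norms *)

(* The norms of MathComp-Analysis on spaces over R[i] are R[i]-valued. *)
Definition cabs (R : realType) (z : R[i]) : R := complex.Re `|z|.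

Definition rnorm (R : realType) (V : normedModType R[i]) (x : V) : R :=
  complex.Re `|x|.

Section ComplexAbs.
Variable R : realType.
Implicit Types z : R[i].

Lemma cabsE z : `|z| = (cabs z)%:C%C.
Proof. by rewrite /cabs RRe_real ?normr_real. Qed.

Lemma cabs_ge0 z : 0 <= cabs z.
Proof. by rewrite -ler0c -cabsE. Qed.

Lemma Re0 : complex.Re (0 : R[i]) = 0. Proof. by []. Qed.

Lemma ReN z : complex.Re (- z) = - complex.Re z. Proof. by case: z. Qed.

Lemma cabs0 : cabs (0 : R[i]) = 0.
Proof. by rewrite /cabs normr0. Qed.

Lemma cabs_eq0 z : cabs z = 0 -> z = 0.
Proof. by move=> z0; apply/eqP; rewrite -normr_eq0 cabsE z0. Qed.

Lemma cabsN z : cabs (- z) = cabs z.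
Proof. by rewrite /cabs normrN. Qed.

Lemma cabsD z z' : cabs (z + z') <= cabs z + cabs z'.
Proof. by rewrite -lecR rmorphD /= -!cabsE ler_normD. Qed.

Lemma cabsM z z' : cabs (z * z') = cabs z * cabs z'.
Proof. by apply: complexI; rewrite rmorphM /= -!cabsE normrM. Qed.

Lemma cabsX z n : cabs (z ^+ n) = cabs z ^+ n.
Proof. by apply: complexI; rewrite rmorphXn /= -!cabsE normrX. Qed.

Lemma cabsV z : cabs z^-1 = (cabs z)^-1.
Proof. by apply: complexI; rewrite fmorphV /= -!cabsE normfV. Qed.

Lemma cabs_real (r : R) : cabs r%:C%C = `|r|.
Proof. by rewrite /cabs normc_def /= expr0n addr0 sqrtr_sqr. Qed.

Lemma conj_mul_cabs z : z^*%C * z = (cabs z ^+ 2)%:C%C.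
Proof. by rewrite mulrC -sqr_normc cabsE rmorphXn. Qed.

Lemma small_cabs_eq0 z : (forall e : R, 0 < e -> cabs z < e) -> z = 0.
Proof.
move=> h; apply: cabs_eq0; apply/eqP; rewrite eq_le cabs_ge0 andbT.
by apply/ler_addgt0Pr => e /h /ltW; rewrite add0r.
Qed.

End ComplexAbs.

Section RealNorm.
Variables (R : realType) (V : normedModType R[i]).
Implicit Types (x y : V) (a : R[i]).

Lemma rnormE x : `|x| = (rnorm x)%:C%C.
Proof. by rewrite /rnorm RRe_real ?normr_real. Qed.

Lemma rnorm_ge0 x : 0 <= rnorm x.
Proof. by rewrite -ler0c -rnormE. Qed.

Lemma rnorm0 : rnorm (0 : V) = 0.
Proof. by rewrite /rnorm normr0. Qed.

Lemma rnorm_eq0 x : rnorm x = 0 -> x = 0.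
Proof. by move=> x0; apply/eqP; rewrite -normr_eq0 rnormE x0. Qed.

Lemma rnormD x y : rnorm (x + y) <= rnorm x + rnorm y.
Proof. by rewrite -lecR rmorphD /= -!rnormE ler_normD. Qed.

Lemma rnormN x : rnorm (- x) = rnorm x.
Proof. by rewrite /rnorm normrN. Qed.

Lemma rnormB x y : rnorm (x - y) <= rnorm x + rnorm y.
Proof. by rewrite -(rnormN y) rnormD. Qed.

Lemma rdistC x y : rnorm (x - y) = rnorm (y - x).
Proof. by rewrite /rnorm distrC. Qed.

Lemma rdistD z x y : rnorm (x - y) <= rnorm (x - z) + rnorm (z - y).
Proof. by rewrite -lecR rmorphD /= -!rnormE ler_distD. Qed.

Lemma rnormZ a x : rnorm (a *: x) = cabs a * rnorm x.
Proof. by apply: complexI; rewrite rmorphM /= -!rnormE normrZ cabsE. Qed.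

Lemma rnorm_sum (I : Type) (r : seq I) (P : pred I) (f : I -> V) :
  rnorm (\sum_(i <- r | P i) f i) <= \sum_(i <- r | P i) rnorm (f i).
Proof.
elim/big_rec2: _ => [|i y1 y2 _ le]; first by rewrite rnorm0.
by apply: (le_trans (rnormD _ _)); rewrite lerD2l.
Qed.

Lemma cvg_rnormP (u : nat -> V) (l : V) :
  u @ \oo --> l <-> forall e : R, 0 < e ->
    exists N, forall n, (N <= n)%N -> rnorm (l - u n) < e.
Proof.
split=> [/cvgrPdist_lt h e e0|h].
  have e0' : 0 < e%:C%C :> R[i] by rewrite ltcR.
  have [N _ hN] := h _ e0'.
  by exists N => n /hN; rewrite rnormE ltcR.
apply/cvgrPdist_lt => e e0.
(* A positive element of [R[i]] has zero imaginary part, so [e] is the image of a real number. *)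
have er : e = (complex.Re e)%:C%C by rewrite RRe_real // gtr0_real.
rewrite er in e0 *.
have [|N hN] := h (complex.Re e); first by rewrite ltcR in e0.
by exists N => // n /hN; rewrite rnormE ltcR.
Qed.

Lemma closure_rnormP (A : set V) x :
  closure A x <-> forall e : R, 0 < e -> exists2 a, A a & rnorm (x - a) < e.
Proof.
split=> [cA e e0|h B].
  have e0' : 0 < e%:C%C :> R[i] by rewrite ltcR.
  have [y [Ay]] := cA _ (nbhsx_ballx x _ e0').
  by rewrite -ball_normE /= rnormE ltcR; exists y.
move/nbhs_ballP => [e /= e0 eB].
have er : e = (complex.Re e)%:C%C by rewrite RRe_real // gtr0_real.
have [|a Aa xa] := h (complex.Re e); first by rewrite er ltcR in e0.
exists a; split => //; apply: eB; rewrite -ball_normE /= rnormE er.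
by rewrite ltcR.
Qed.

End RealNorm.

Lemma rnorm_complete (R : realType) (V : completeNormedModType R[i])
    (u : nat -> V) :
  (forall e : R, 0 < e -> exists N, forall m n, (N <= m)%N -> (N <= n)%N ->
     rnorm (u m - u n) < e) ->
  exists l : V, u @ \oo --> l.
Proof.
move=> h; suff : cvgn u by move=> /cvg_ex.
apply: cauchy_cvg; apply/cauchyP => e e0.
have er : e = (complex.Re e)%:C%C by rewrite RRe_real // gtr0_real.
have [|N hN] := h (complex.Re e); first by rewrite er ltcR in e0.
exists (u N), N => // n Nn /=; rewrite -ball_normE /= rnormE er.
by rewrite ltcR; apply: hN.
Qed.

(** * Hilbert spaces *)

Section InnerProduct.
Variables (R : realType) (H : hilbertType R).
Implicit Types (x y z : H) (a : R[i]).

Lemma hnormE x : hnorm x = rnorm x. Proof. by []. Qed.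

Lemma hdotxxE x : hdot x x = (rnorm x ^+ 2)%:C%C.
Proof. by rewrite hdotxx rnormE rmorphXn. Qed.

Lemma hdotDl x y z : hdot (x + y) z = hdot x z + hdot y z.
Proof. by rewrite hdotC hdotDr rmorphD /= -!hdotC. Qed.

Lemma hdotZl a x y : hdot (a *: x) y = a^*%C * hdot x y.
Proof. by rewrite hdotC hdotZr rmorphM /= -hdotC. Qed.

Lemma hdot0r x : hdot x 0 = 0.
Proof. by rewrite -(scale0r 0) hdotZr mul0r. Qed.

Lemma hdot0l x : hdot 0 x = 0.
Proof. by rewrite hdotC hdot0r conjc0. Qed.

Lemma hdotNr x y : hdot x (- y) = - hdot x y.
Proof. by rewrite -scaleN1r hdotZr mulN1r. Qed.

Lemma hdotNl x y : hdot (- x) y = - hdot x y.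
Proof. by rewrite hdotC hdotNr rmorphN /= -hdotC. Qed.

Lemma hdotBr x y z : hdot x (y - z) = hdot x y - hdot x z.
Proof. by rewrite hdotDr hdotNr. Qed.

Lemma hdotBl x y z : hdot (x - y) z = hdot x z - hdot y z.
Proof. by rewrite hdotDl hdotNl. Qed.

Lemma hdot_sumr (I : Type) (r : seq I) (P : pred I) (f : I -> H) x :
  hdot x (\sum_(i <- r | P i) f i) = \sum_(i <- r | P i) hdot x (f i).
Proof.
elim/big_rec2: _ => [|i y1 y2 _ <-]; first by rewrite hdot0r.
by rewrite hdotDr.
Qed.

Lemma hdot_suml (I : Type) (r : seq I) (P : pred I) (f : I -> H) x :
  hdot (\sum_(i <- r | P i) f i) x = \sum_(i <- r | P i) hdot (f i) x.
Proof.
elim/big_rec2: _ => [|i y1 y2 _ <-]; first by rewrite hdot0l.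
by rewrite hdotDl.
Qed.

Lemma rnorm_sqrD x y :
  rnorm (x + y) ^+ 2 = rnorm x ^+ 2 + rnorm y ^+ 2 + 2 * complex.Re (hdot x y).
Proof.
apply: complexI; rewrite -hdotxxE hdotDl !hdotDr !hdotxxE (hdotC y x).
rewrite !rmorphD /=.
have -> : (2 * complex.Re (hdot x y))%:C%C = hdot x y + (hdot x y)^*%C.
  by rewrite rmorphM /= rmorph_nat addcJ.
ring.
Qed.

Lemma parallelogram x y :
  rnorm (x + y) ^+ 2 + rnorm (x - y) ^+ 2 = 2 * (rnorm x ^+ 2 + rnorm y ^+ 2).
Proof. by rewrite !rnorm_sqrD rnormN hdotNr ReN; ring. Qed.

(** Pythagoras for [x] minus its component along [y]. Nonnegativity of the left side is
    Cauchy-Schwarz, and the same decrease shows that a nearest point leaves an orthogonal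
    residual. *)
Lemma rnorm_sqr_residual x y : y != 0 ->
  rnorm (x - (hdot y x / (rnorm y ^+ 2)%:C%C) *: y) ^+ 2 =
  rnorm x ^+ 2 - cabs (hdot y x) ^+ 2 / rnorm y ^+ 2.
Proof.
move=> y0; have ny0 : rnorm y != 0.
  by apply: contra y0 => /eqP/rnorm_eq0 ->.
have ny0' : (rnorm y ^+ 2)%:C%C != 0 :> R[i].
  by rewrite fmorph_eq0 expf_neq0.
apply: complexI; rewrite rmorphB /= [(_ / rnorm y ^+ 2)%:C%C]rmorphM /=.
rewrite fmorphV /= -conj_mul_cabs -hdotxxE.
have cq (z : R[i]) (r : R) : (z / r%:C%C)^*%C = z^*%C / r%:C%C.
  by rewrite rmorphM; congr (_ * _); exact: etrans (conjc_inv _) (congr1 _ (conjc_real r)).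
move: ny0' (hdotxxE y) (cq (hdot y x) (rnorm y ^+ 2)); set d := (rnorm y ^+ 2)%:C%C.
move=> d0 yy {}cq.
rewrite hdotBl !hdotBr !hdotZr !hdotZl yy (hdotC x y) cq (hdotxxE x).
clearbody d; move: (rnorm x ^+ 2)%:C%C (hdot y x) (_ ^*%C) => A B C.
by field.
Qed.

Lemma cauchy_schwarz x y : cabs (hdot x y) <= rnorm x * rnorm y.
Proof.
have [->|x0] := eqVneq x 0; first by rewrite hdot0l rnorm0 cabs0 mul0r.
have nx : 0 < rnorm x.
  rewrite lt_neqAle rnorm_ge0 andbT eq_sym.
  by apply: contra x0 => /eqP/rnorm_eq0 ->.
have := sqr_ge0 (rnorm (y - (hdot x y / (rnorm x ^+ 2)%:C%C) *: x)).
rewrite rnorm_sqr_residual // subr_ge0 ler_pdivrMr ?exprn_gt0 // -exprMn.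
by rewrite ler_pXn2r ?nnegrE ?mulr_ge0 ?rnorm_ge0 ?cabs_ge0 // mulrC.
Qed.

Lemma pythagoras (I : eqType) (r : seq I) (f : I -> H) : uniq r ->
  (forall i j, i != j -> hdot (f i) (f j) = 0) ->
  rnorm (\sum_(i <- r) f i) ^+ 2 = \sum_(i <- r) rnorm (f i) ^+ 2.
Proof.
move=> + fo; elim: r => [|i r IH] /=; first by rewrite !big_nil rnorm0 expr0n.
case/andP => ir ur; rewrite !big_cons rnorm_sqrD IH // hdot_sumr.
have -> : \sum_(j <- r) hdot (f i) (f j) = 0.
  by apply: big1_seq => j /= jr; apply: fo; apply: contraNneq ir => ->.
by rewrite Re0 mulr0 addr0.
Qed.

Lemma hdot_cvgr (u : nat -> H) l x : u @ \oo --> l ->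
  forall e : R, 0 < e ->
    exists N, forall n, (N <= n)%N -> cabs (hdot x l - hdot x (u n)) < e.
Proof.
move=> /cvg_rnormP ul e e0.
(* Adding 1 keeps the divisor positive even for [x = 0]; the same device recurs in later
   estimates. *)
have p : 0 < rnorm x + 1 by rewrite ltr_wpDl ?rnorm_ge0.
have [|N hN] := ul (e / (rnorm x + 1)); first by rewrite divr_gt0.
exists N => n /hN; rewrite ltr_pdivlMr // -hdotBr; apply: le_lt_trans.
rewrite (le_trans (cauchy_schwarz _ _))// mulrC ler_wpM2l ?rnorm_ge0//.
by rewrite lerDl.
Qed.

Lemma hdot_lim_eq (u : nat -> H) l x (c : R[i]) : u @ \oo --> l ->
  (exists N, forall n, (N <= n)%N -> hdot x (u n) = c) -> hdot x l = c.
Proof.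
move=> ul [N hN]; apply/eqP; rewrite -subr_eq0; apply/eqP.
apply: small_cabs_eq0 => e e0; have [M hM] := hdot_cvgr x ul e0.
have := hM (maxn N M); rewrite hN ?leq_maxl //; apply; exact: leq_maxr.
Qed.

Lemma rnorm_lim_le (u : nat -> H) l x (B : R) : u @ \oo --> l ->
  (exists N, forall n, (N <= n)%N -> rnorm (u n - x) <= B) -> rnorm (l - x) <= B.
Proof.
move=> /cvg_rnormP ul [N hN]; apply/ler_addgt0Pr => e e0.
have [M hM] := ul e e0.
rewrite (le_trans (rdistD (u (maxn N M)) _ _))// addrC lerD ?hN ?leq_maxl//.
by rewrite ltW // hM // leq_maxr.
Qed.

End InnerProduct.

(** * Linear subspaces, closures and closed spans *)

Definition linear_subspace (R : realType) (V : normedModType R[i]) (S : set V) :=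
  S 0 /\ forall (a : R[i]) x y, S x -> S y -> S (a *: x + y).

Section Subspaces.
Variables (R : realType) (V : normedModType R[i]).
Implicit Types (S A : set V).

Lemma subspaceD S x y : linear_subspace S -> S x -> S y -> S (x + y).
Proof. by move=> [_ h] Sx Sy; rewrite -(scale1r x); apply: h. Qed.

Lemma subspaceZ S a x : linear_subspace S -> S x -> S (a *: x).
Proof. by move=> [S0 h] Sx; rewrite -(addr0 (a *: x)); apply: h. Qed.

Lemma subspaceB S x y : linear_subspace S -> S x -> S y -> S (x - y).
Proof.
by move=> hS Sx Sy; apply: subspaceD => //; rewrite -scaleN1r; apply: subspaceZ.
Qed.

Lemma subspace_sum S (I : Type) (r : seq I) (P : pred I) (f : I -> V) :
  linear_subspace S -> (forall i, P i -> S (f i)) -> S (\sum_(i <- r | P i) f i).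
Proof.
move=> hS Sf; elim/big_rec: _ => [|i x Pi Sx]; first by case: hS.
by apply: subspaceD => //; apply: Sf.
Qed.

Lemma lspan_sub S A : linear_subspace S -> A `<=` S -> lspan A `<=` S.
Proof.
move=> hS AS x [n [c [a [Aa ->]]]]; apply: subspace_sum => // i _.
by apply: subspaceZ => //; apply: AS.
Qed.

Lemma mem_lspan A x : A x -> lspan A x.
Proof.
move=> Ax; exists 1%N, (fun=> 1), (fun=> x); split => //.
by rewrite big_ord1 scale1r.
Qed.

Lemma lspan_subspace A : linear_subspace (lspan A).
Proof.
split; first by exists 0%N, (fun=> 0), (fun=> 0); split; [case|rewrite big_ord0].
move=> k x y [n [c [a [Aa ->]]]] [m [d [b [Ab ->]]]].
exists (n + m)%N, (fun i => match fintype.split i with inl i => k * c i | inr i => d i end),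
  (fun i => match fintype.split i with inl i => a i | inr i => b i end); split.
  by move=> i; case: fintype.splitP.
rewrite big_split_ord scaler_sumr; congr (_ + _).
  apply: eq_bigr => i _; rewrite scalerA.
  by rewrite (unsplitK (inl i : 'I_n + 'I_m)).
by apply: eq_bigr => i _; rewrite (unsplitK (inr i : 'I_n + 'I_m)).
Qed.

Lemma closure_subspace S : linear_subspace S -> linear_subspace (closure S).
Proof.
move=> [S0 hS]; split; first exact: subset_closure.
move=> a x y /closure_rnormP cx /closure_rnormP cy; apply/closure_rnormP => e e0.
have p : 0 < cabs a + 1 by rewrite ltr_wpDl ?cabs_ge0.
have [|x' Sx' hx] := cx (e / 2 / (cabs a + 1)); first by rewrite !divr_gt0.
have [|y' Sy' hy] := cy (e / 2); first by rewrite divr_gt0.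
exists (a *: x' + y'); first exact: hS.
rewrite opprD addrACA -scalerBr (le_lt_trans (rnormD _ _))// [e in _ < e]splitr.
apply: ltr_leD; last exact: ltW.
move: hx; rewrite rnormZ ltr_pdivlMr //; apply: le_lt_trans.
by rewrite mulrC ler_wpM2l ?rnorm_ge0// lerDl.
Qed.

Lemma closed_sub S A : closed S -> A `<=` S -> closure A `<=` S.
Proof. by move=> cS /closureS AS x /AS; rewrite -(closure_id S).1. Qed.

Lemma closed_rnormP S :
  (forall x, (forall e : R, 0 < e -> exists2 a, S a & rnorm (x - a) < e) -> S x) ->
  closed S.
Proof. by move=> h x /closure_rnormP; apply: h. Qed.

Lemma closed_lim S (u : nat -> V) l : closed S -> (forall n, S (u n)) ->
  u @ \oo --> l -> S l.
Proof.
move=> cS Su /cvg_rnormP ul; apply: cS; apply/closure_rnormP => e e0.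
by have [N /(_ N (leqnn N)) ?] := ul e e0; exists (u N).
Qed.

End Subspaces.

Section ClosedSpan.
Variables (R : realType) (H : hilbertType R).
Implicit Types A S : set H.

Lemma closed_span_closed A : closed (closed_span A).
Proof. exact: closed_closure. Qed.

Lemma closed_span_subspace A : linear_subspace (closed_span A).
Proof. exact: closure_subspace (lspan_subspace A). Qed.

Lemma mem_closed_span A x : A x -> closed_span A x.
Proof. by move=> /mem_lspan; apply: subset_closure. Qed.

Lemma closed_span_sub A S : linear_subspace S -> closed S -> A `<=` S ->
  closed_span A `<=` S.
Proof. by move=> lS cS AS; apply: closed_sub => //; apply: lspan_sub. Qed.

End ClosedSpan.

(** * Orthogonal projection and Riesz representation *)

Section Projection.
Variables (R : realType) (H : hilbertType R) (S : set H).
Hypotheses (lS : linear_subspace S) (cS : closed S).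

(** A minimizing sequence is Cauchy by the parallelogram law, since midpoints of its members stay in
    [S]; completeness gives a limit. *)
Lemma nearest_point (f : H) : exists2 p, S p & forall s, S s -> rnorm (f - p) <= rnorm (f - s).
Proof.
pose D := [set rnorm (f - s) | s in S].
have D0 : D !=set0 by exists (rnorm (f - 0)), 0 => //; case: lS.
have Dlb : has_lbound D by exists 0 => _ [s _ <-]; apply: rnorm_ge0.
pose d := inf D.
have dle s : S s -> d <= rnorm (f - s) by move=> Ss; apply: ge_inf => //; exists s.
have d0 : 0 <= d by apply: lb_le_inf => // _ [s _ <-]; apply: rnorm_ge0.
have ex n : exists s, S s /\ rnorm (f - s) < d + n.+1%:R^-1.
  have [|_ [s Ss <-] hs] := @inf_adherent _ D n.+1%:R^-1 _ (conj D0 Dlb).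
    by rewrite invr_gt0 ltr0n.
  by exists s.
have {}[u hu] := choice ex.
have dist m n : rnorm (u m - u n) ^+ 2 <=
    2 * ((d + m.+1%:R^-1) ^+ 2 + (d + n.+1%:R^-1) ^+ 2) - 4 * d ^+ 2.
  have := parallelogram (f - u m) (f - u n).
  have -> : f - u m - (f - u n) = u n - u m.
    by rewrite opprB addrC addrA subrK.
  have -> : f - u m + (f - u n) = 2%:R *: (f - 2%:R^-1 *: (u m + u n)).
    rewrite scalerBr scalerA divff ?pnatr_eq0 // scale1r scaler_nat mulr2n.
    by rewrite addrACA opprD.
  rewrite rnormZ (rdistC (u n)).
  have -> : cabs (2%:R : R[i]) = 2.
    by rewrite -(rmorph_nat (real_complex R)) cabs_real ger0_norm.
  have h1 : d <= rnorm (f - 2%:R^-1 *: (u m + u n)).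
    by apply: dle; apply: subspaceZ => //; apply: subspaceD => //; case: (hu m); case: (hu n).
  have := (hu m).2; have := (hu n).2.
  have := dle _ (hu m).1; have := dle _ (hu n).1.
  move: h1; set A := rnorm (f - _); set P := rnorm (f - u m); set Q := rnorm (f - u n).
  set X := rnorm _; set a := _^-1; set b := _^-1.
  move=> dA dQ dP hQ hP par.
  have P2 : P ^+ 2 <= (d + b) ^+ 2.
    apply: lerXn2r; rewrite ?nnegrE ?rnorm_ge0 //; last exact: ltW.
    by rewrite (le_trans _ (ltW hP)) ?rnorm_ge0.
  have Q2 : Q ^+ 2 <= (d + a) ^+ 2.
    apply: lerXn2r; rewrite ?nnegrE ?rnorm_ge0 //; last exact: ltW.
    by rewrite (le_trans _ (ltW hQ)) ?rnorm_ge0.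
  have A2 : d ^+ 2 <= A ^+ 2 by apply: lerXn2r; rewrite ?nnegrE ?rnorm_ge0.
  have : (2 * A) ^+ 2 = 4 * A ^+ 2 by ring.
  by move=> E; rewrite E in par; lra.
have [|l ul] := @rnorm_complete _ _ u.
  move=> e e0.
  (* For [a, b <= 1] the bound [dist] is at most [(4 d + 2) (a + b)]; this [N] makes [a (8 d + 4)]
     and [b (8 d + 4)] smaller than [e ^+ 2]. *)
  pose N := Num.truncn ((8 * d + 4) / e ^+ 2).
  have hN : ((8 * d + 4) / e ^+ 2) < N.+1%:R by rewrite truncnS_gt.
  exists N => m n Nm Nn.
  rewrite -(@ltr_pXn2r _ 2) ?nnegrE ?rnorm_ge0 ?ltW//.
  apply: le_lt_trans (dist m n) _.
  have inv k : (N <= k)%N -> [/\ 0 < k.+1%:R^-1 :> R, k.+1%:R^-1 <= 1 :> R &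
      (k.+1%:R^-1 : R) * (8 * d + 4) < e ^+ 2].
    move=> Nk; split; first by rewrite invr_gt0 ltr0n.
      by rewrite invf_le1 ?ler1n ?ltr0n.
    rewrite mulrC ltr_pdivrMr ?ltr0n // [_ * _.+1%:R]mulrC -ltr_pdivrMr ?exprn_gt0 //.
    by apply: (lt_le_trans hN); rewrite ler_nat.
  have [a0 a1 ae] := inv m Nm; have [b0 b1 be] := inv n Nn.
  move: a0 a1 ae b0 b1 be; set a := m.+1%:R^-1; set b := n.+1%:R^-1 => *.
  nra.
exists l; first exact: closed_lim cS (fun n => (hu n).1) ul.
move=> s Ss; apply: le_trans (dle s Ss).
apply/ler_addgt0Pr => e e0; rewrite rdistC; apply: (rnorm_lim_le ul).
exists (Num.truncn e^-1) => n Nn; rewrite rdistC.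
apply: le_trans (ltW (hu n).2) _; rewrite lerD2l invf_ple ?posrE ?ltr0n//.
by rewrite (le_trans (ltW (truncnS_gt _)))// ler_nat.
Qed.

Lemma orth_projP (f : H) :
  S (orth_proj S f) /\ forall g, S g -> hdot g (f - orth_proj S f) = 0.
Proof.
have [p Sp pmin] := nearest_point f.
suff op : forall g, S g -> hdot g (f - p) = 0.
  by rewrite /orth_proj; case: xgetP => [q -> //|/(_ p)]; case.
move=> g Sg; have [->|g0] := eqVneq g 0; first by rewrite hdot0l.
have ng : 0 < rnorm g ^+ 2.
  rewrite exprn_gt0 // lt_neqAle rnorm_ge0 andbT eq_sym.
  by apply: contra g0 => /eqP/rnorm_eq0 ->.
(* Moving [p] by [c *: g] lowers the squared distance by [|<g, f - p>|^2 / |g|^2], which minimality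
   forces to be 0. *)
set c := hdot g (f - p) / (rnorm g ^+ 2)%:C%C.
have := pmin (p + c *: g) (subspaceD lS Sp (subspaceZ _ lS Sg)).
rewrite opprD addrA -(@ler_pXn2r _ 2) ?nnegrE ?rnorm_ge0 //.
rewrite rnorm_sqr_residual // lerBrDr gerDl pmulr_lle0 ?invr_gt0 //.
rewrite -[X in _ <= X](expr0n R 2) ler_pXn2r ?nnegrE ?cabs_ge0 // => h.
by apply: cabs_eq0; apply/eqP; rewrite eq_le h cabs_ge0.
Qed.

Lemma orth_proj_uniq (f p : H) : S p -> (forall g, S g -> hdot g (f - p) = 0) ->
  orth_proj S f = p.
Proof.
have [Sq oq] := orth_projP f => Sp op.
set q := orth_proj S f in Sq oq *.
have Sd : S (q - p) by apply: subspaceB.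
apply/eqP; rewrite -subr_eq0; apply/eqP/rnorm_eq0.
have : hdot (q - p) (q - p) = 0.
  have -> : hdot (q - p) (q - p) = hdot (q - p) (f - p - (f - q)).
    by congr hdot; rewrite opprB [RHS]addrC addrA subrK.
  by rewrite hdotBr op // oq // subrr.
by rewrite hdotxxE => /eqP; rewrite fmorph_eq0 expf_eq0 /= => /eqP.
Qed.

Lemma orth_proj_linear a x y :
  orth_proj S (a *: x + y) = a *: orth_proj S x + orth_proj S y.
Proof.
have [Sx ox] := orth_projP x; have [Sy oy] := orth_projP y.
apply: orth_proj_uniq; first by case: lS => _; apply.
by move=> g Sg; rewrite opprD addrACA -scalerBr hdotDr hdotZr ox // oy // mulr0 addr0.
Qed.

Lemma orth_proj_id x : S x -> orth_proj S x = x.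
Proof. by move=> Sx; apply: orth_proj_uniq => // g _; rewrite subrr hdot0r. Qed.

Lemma orth_proj_eq0 x : (forall g, S g -> hdot g x = 0) -> orth_proj S x = 0.
Proof. by move=> h; apply: orth_proj_uniq; rewrite ?subr0 //; case: lS. Qed.

Lemma hdot_orth_proj g x : S g -> hdot g (orth_proj S x) = hdot g x.
Proof.
by move=> Sg; apply/eqP; rewrite -subr_eq0 -hdotBr -oppr_eq0 -hdotNr opprB (orth_projP x).2.
Qed.

Lemma rnorm_orth_proj_le x : rnorm (orth_proj S x) <= rnorm x.
Proof.
have [Sp op] := orth_projP x.
rewrite -(@ler_pXn2r _ 2) ?nnegrE ?rnorm_ge0 //.
have -> : rnorm x ^+ 2 = rnorm (orth_proj S x + (x - orth_proj S x)) ^+ 2.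
  by rewrite addrC subrK.
rewrite (rnorm_sqrD (orth_proj S x)) op // Re0 mulr0 addr0 lerDl.
exact: sqr_ge0.
Qed.

End Projection.

(** The kernel of [L] is closed; the residual [z] of a point outside it is orthogonal to it, and
    every [x] differs from a multiple of [z] by an element of the kernel. *)
Lemma riesz (R : realType) (H : hilbertType R) (L : H -> R[i]) (M : R) :
  (forall a x y, L (a *: x + y) = a * L x + L y) ->
  (forall x, cabs (L x) <= M * rnorm x) ->
  exists eta, forall x, L x = hdot eta x.
Proof.
move=> Ll Lb.
have L0 : L 0 = 0 by apply: (addrI (L 0)); rewrite -{1}(mul1r (L 0)) -Ll scaler0 !addr0.
have LB x y : L (x - y) = L x - L y by rewrite addrC -scaleN1r Ll mulN1r addrC.
pose S := [set x | L x = 0].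
have lS : linear_subspace S.
  by split => // a x y; rewrite /S /= Ll => -> ->; rewrite mulr0 addr0.
have M0 : 0 < `|M| + 1 by rewrite ltr_wpDl.
have cS : closed S.
  apply: closed_rnormP => x hx; apply: small_cabs_eq0 => e e0.
  have [|a La xa] := hx (e / (`|M| + 1)); first by rewrite divr_gt0.
  move: xa; rewrite ltr_pdivlMr // => /(le_lt_trans _); apply.
  have -> : L x = L (x - a) by rewrite LB La subr0.
  rewrite (le_trans (Lb _))// mulrC ler_wpM2l ?rnorm_ge0//.
  by rewrite (le_trans (ler_norm M))// lerDl.
have [[x0 Lx0]|allS] := pselect (exists x, L x != 0); last first.
  exists 0 => x; rewrite hdot0l; apply/eqP; apply: contrapT => /negP Lx.
  by apply: allS; exists x.
have [SP oP] := orth_projP lS cS x0.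
set z := x0 - orth_proj S x0 in oP.
have Lz : L z != 0 by rewrite LB SP subr0.
have zz : hdot z z != 0.
  rewrite hdotxxE fmorph_eq0 expf_eq0 /=; apply: contra Lz => /eqP/rnorm_eq0 ->.
  by rewrite L0.
exists ((L z / hdot z z)^*%C *: z) => x; rewrite hdotZl conjcK.
have : hdot z (x - (L x / L z) *: z) = 0.
  rewrite hdotC oP ?conjc0 // /S /= LB -[_ *: z]addr0 Ll L0 addr0.
  by rewrite divfK // subrr.
rewrite hdotBr hdotZr => /eqP; rewrite subr_eq0 => /eqP ->.
by field; rewrite Lz zz.
Qed.

(** * Extension of densely defined bounded maps *)

Section Extension.
Variables (R : realType) (V : normedModType R[i]) (W : completeNormedModType R[i]).
Variables (T : Type).

(** Formal combinations are lists of pairs, and the vectors [e t] may satisfy linear relations: the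
    norm comparison [e'_le] is what makes the induced map well defined. *)
Definition combination (U : normedModType R[i]) (e : T -> U) (p : seq (R[i] * T)) : U :=
  \sum_(x <- p) x.1 *: e x.2.

Definition combine (a : R[i]) (p q : seq (R[i] * T)) : seq (R[i] * T) :=
  [seq (a * x.1, x.2) | x <- p] ++ q.

Lemma combination_combine (U : normedModType R[i]) (e : T -> U) a p q :
  combination e (combine a p q) = a *: combination e p + combination e q.
Proof.
rewrite /combination /combine big_cat big_map scaler_sumr; congr (_ + _).
by apply: eq_bigr => x _; rewrite scalerA.
Qed.

Lemma combination1 (U : normedModType R[i]) (e : T -> U) t :
  combination e [:: (1, t)] = e t.
Proof. by rewrite /combination big_seq1 scale1r. Qed.

Variables (e : T -> V) (e' : T -> W) (M : R).
Hypothesis M0 : 0 <= M.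
Hypothesis e_dense : forall x (d : R), 0 < d ->
  exists p, rnorm (x - combination e p) < d.
Hypothesis e'_le : forall p,
  rnorm (combination e' p) <= M * rnorm (combination e p).

(* The closure of the graph of the densely defined map. *)
Let graph x y := forall d : R, 0 < d -> exists p,
  rnorm (x - combination e p) < d /\ rnorm (y - combination e' p) < d.

Let graph_combination p : graph (combination e p) (combination e' p).
Proof. by move=> d d0; exists p; rewrite !subrr !rnorm0. Qed.

Let graph_linear a x y x' y' : graph x y -> graph x' y' ->
  graph (a *: x + x') (a *: y + y').
Proof.
move=> gx gx' d d0.
have p0 : 0 < cabs a + 1 by rewrite ltr_wpDl ?cabs_ge0.
have [|p [hp hp']] := gx (d / 2 / (cabs a + 1)); first by rewrite !divr_gt0.
have [|q [hq hq']] := gx' (d / 2); first by rewrite divr_gt0.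
have key (U : normedModType R[i]) (f g f' g' : U) :
    rnorm (f - g) < d / 2 / (cabs a + 1) -> rnorm (f' - g') < d / 2 ->
    rnorm (a *: f + f' - (a *: g + g')) < d.
  move=> h h'; rewrite opprD addrACA -scalerBr (le_lt_trans (rnormD _ _))//.
  rewrite [d in _ < d]splitr; apply: ltr_leD; last exact: ltW.
  move: h; rewrite rnormZ ltr_pdivlMr //; apply: le_lt_trans.
  by rewrite mulrC ler_wpM2l ?rnorm_ge0// lerDl.
by exists (combine a p q); rewrite !combination_combine; split; apply: key.
Qed.

(** With linearity this makes the graph single-valued: two values over one point differ by a value
    over 0. *)
Let graph_bound x y : graph x y -> rnorm y <= M * rnorm x.
Proof.
move=> g; apply/ler_addgt0Pr => d d0.
have p0 : 0 < M + 1 by rewrite ltr_wpDl.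
have [|p [hp hp']] := g (d / (M + 1)); first by rewrite divr_gt0.
have -> : y = (y - combination e' p) + combination e' p by rewrite subrK.
rewrite (le_trans (rnormD _ _))//.
have h1 : rnorm (combination e p) <= rnorm x + d / (M + 1).
  have -> : combination e p = x - (x - combination e p) by rewrite subKr.
  by rewrite (le_trans (rnormB _ _))// lerD2l ltW.
have h2 := e'_le p.
have h3 : M * rnorm (combination e p) <= M * (rnorm x + d / (M + 1)) by apply: ler_wpM2l.
have h4 : d = d / (M + 1) * (M + 1) by rewrite divfK // gt_eqF.
rewrite [in leRHS]h4 addrC; nra.
Qed.

Let graph_ex x : exists y, graph x y.
Proof.
have ex n : exists p, rnorm (x - combination e p) < n.+1%:R^-1.
  by apply: e_dense; rewrite invr_gt0 ltr0n.
have [p hp] := choice ex.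
have small (d : R) : 0 < d -> exists N, forall n, (N <= n)%N -> n.+1%:R^-1 < d.
  move=> d0; exists (Num.truncn d^-1) => n Nn.
  rewrite invf_plt ?posrE ?ltr0n // (lt_le_trans (truncnS_gt _))//.
  by rewrite ler_nat.
have [|y py] := @rnorm_complete _ _ (fun n => combination e' (p n)).
  move=> d d0; have p0 : 0 < M + 1 by rewrite ltr_wpDl.
  have [|N hN] := small (d / 2 / (M + 1)); first by rewrite !divr_gt0.
  exists N => m n Nm Nn.
  (* The coefficient -1 turns [combine] into a formal difference of two approximants. *)
  have := e'_le (combine (-1) (p n) (p m)).
  rewrite !combination_combine !scaleN1r addrC [- _ + _]addrC.
  move=> /le_lt_trans; apply.
  have hX := rdistD x (combination e (p m)) (combination e (p n)).
  rewrite (rdistC (combination e (p m)) x) in hX.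
  have := lt_trans (hp _) (hN _ Nm); have := lt_trans (hp _) (hN _ Nn).
  rewrite !ltr_pdivlMr //.
  move: (rnorm_ge0 (combination e (p m) - combination e (p n))) hX.
  set X := rnorm _; set a := rnorm _; set b := rnorm _ => X0 hX hb ha.
  have : X * (M + 1) <= (a + b) * (M + 1) by rewrite ler_pM2r.
  lra.
exists y => d d0; have /cvg_rnormP/(_ _ d0)[N1 h1] := py.
have [N2 h2] := small _ d0.
exists (p (maxn N1 N2)); split; last by apply: h1; rewrite leq_maxl.
by apply: (lt_trans (hp _)); apply: h2; rewrite leq_maxr.
Qed.

Lemma bounded_extension : exists L : V -> W,
  [/\ forall a x y, L (a *: x + y) = a *: L x + L y,
      forall x, rnorm (L x) <= M * rnorm x &
      forall p, L (combination e p) = combination e' p].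
Proof.
have [L hL] := choice graph_ex.
have uniq x y : graph x y -> L x = y.
  move=> gy; apply/eqP; rewrite -subr_eq0; apply/eqP/rnorm_eq0/eqP.
  rewrite eq_le rnorm_ge0 andbT.
  have := graph_bound (graph_linear (-1) gy (hL x)).
  by rewrite !scaleN1r addNr rnorm0 mulr0 addrC.
exists L; split => [a x y|x|p]; last exact: uniq.
  by apply: uniq; apply: graph_linear.
exact: graph_bound.
Qed.

End Extension.

(** * Estimates for finite real sums *)

Section RealSums.
Variable R : realType.
Implicit Types (x y a b : nat -> R).

(** Lagrange's identity: the double sum of squares is twice the defect of the inequality. *)
Lemma sum_cauchy_schwarz n a b :
  (\sum_(i < n) a i * b i) ^+ 2 <= (\sum_(i < n) a i ^+ 2) * (\sum_(i < n) b i ^+ 2).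
Proof.
have : 0 <= \sum_(i < n) \sum_(j < n) (a i * b j - a j * b i) ^+ 2.
  by apply: sumr_ge0 => i _; apply: sumr_ge0 => j _; apply: sqr_ge0.
have -> : \sum_(i < n) \sum_(j < n) (a i * b j - a j * b i) ^+ 2 =
   (\sum_(i < n) a i ^+ 2) * (\sum_(j < n) b j ^+ 2)
   + (\sum_(i < n) b i ^+ 2) * (\sum_(j < n) a j ^+ 2)
   - 2 * ((\sum_(i < n) a i * b i) * (\sum_(j < n) a j * b j)).
  rewrite !big_distrlr /= mulr_sumr -big_split -sumrB /=.
  apply: eq_bigr => i _; rewrite mulr_sumr -big_split -sumrB /=.
  by apply: eq_bigr => j _; ring.
lra.
Qed.

(** The pairs [(k, n - k)] with [n < N] form a triangle inside the [N] by [N] square of index pairs,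
    and all terms are nonnegative. *)
Lemma sum_convolution_le N x y : (forall n, 0 <= x n) -> (forall n, 0 <= y n) ->
  \sum_(n < N) convolution x y n <= (\sum_(n < N) x n) * (\sum_(n < N) y n).
Proof.
move=> x0 y0; rewrite /convolution big_distrlr /=.
under eq_bigr => n _ do rewrite (big_ord_widen _ (fun k => x k * y (n - k)%N) (ltn_ord n)).
rewrite (exchange_big_dep xpredT) //=; apply: ler_sum => k _.
rewrite -!mulr_sumr ler_wpM2l //.
rewrite -(big_mkord (fun n => k < n.+1)%N (fun n => y (n - k)%N)).
rewrite -(big_mkord xpredT).
have -> : \sum_(0 <= n < N | (k < n.+1)%N) y (n - k)%N = \sum_(k <= n < N) y (n - k)%N.
  by rewrite [RHS](@big_nat_widenl _ _ _ _ 0%N).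
rewrite -{1}(add0n (val k)) big_addn.
rewrite [leRHS](@big_cat_nat _ _ _ (N - k)%N) ?leq_subr //=.
under eq_bigr => i _ do rewrite addnK.
by rewrite lerDl sumr_ge0.
Qed.

End RealSums.

(** * Density of the elementary tensors *)

Lemma fock_dense (R : realType) (H : hilbertType R) (w : nat -> R)
    (F : fock_space H w) (x : F) (d : R) : 0 < d ->
  exists p, rnorm (x - combination (tens F) p) < d.
Proof.
move=> d0; have : closed_span (range (tens F)) x by rewrite tens_dense.
move=> /closure_rnormP/(_ d d0)[_ [n [c [a [Ra ->]]]] xa].
have /choice[v hv] : forall i, exists v, tens F v = a i.
  by move=> i; have [v _ <-] := Ra i; exists v.
exists [seq (c i, v i) | i <- enum 'I_n].
suff -> : combination (tens F) [seq (c i, v i) | i <- enum 'I_n] =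
  \sum_(i < n) c i *: a i by [].
by rewrite /combination big_map big_enum; apply: eq_bigr => i _; rewrite /= hv.
Qed.

(** The Riesz vector of [D] is orthogonal to a dense subspace. Linear identities between bounded
    expressions thus need checking on elementary tensors only. *)
Lemma fock_eq0 (R : realType) (H : hilbertType R) (w : nat -> R)
    (F : fock_space H w) (D : F -> R[i]) (M : R) :
  (forall a x y, D (a *: x + y) = a * D x + D y) ->
  (forall x, cabs (D x) <= M * rnorm x) ->
  (forall u, D (tens F u) = 0) -> forall x, D x = 0.
Proof.
move=> Dl /(riesz Dl)[xi Dxi] Dt x; rewrite Dxi.
suff -> : xi = 0 by rewrite hdot0l.
have orth : forall y, hdot xi y = 0.
  move=> y; apply: small_cabs_eq0 => e e0.
  have p0 : 0 < rnorm xi + 1 by rewrite ltr_wpDl ?rnorm_ge0.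
  have [|p hp] := @fock_dense _ _ _ F y (e / (rnorm xi + 1)); first by rewrite divr_gt0.
  have -> : hdot xi y = hdot xi (y - combination (tens F) p).
    rewrite hdotBr /combination hdot_sumr big1 ?subr0 // => t _.
    by rewrite hdotZr -Dxi Dt mulr0.
  move: hp; rewrite ltr_pdivlMr //; apply: le_lt_trans.
  rewrite (le_trans (cauchy_schwarz _ _))// mulrC ler_wpM2l ?rnorm_ge0//.
  by rewrite lerDl.
apply: rnorm_eq0; have := hdotxxE xi; rewrite orth => /eqP.
by rewrite eq_sym fmorph_eq0 expf_eq0 => /eqP.
Qed.

(** * Boundedness of the tensor product *)

Section TensorProduct.
Variables (R : realType) (H : hilbertType R) (w : nat -> R) (F : fock_space H w).
Hypothesis w_gt0 : forall n, 0 < w n.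

Local Notation formal := (seq (R[i] * seq H)).
Implicit Types p q : formal.

Definition degree_part p k : F := \sum_(x <- p | size x.2 == k) x.1 *: tens F x.2.

Definition formal_tensor p q : F :=
  \sum_(x <- p) \sum_(y <- q) (x.1 * y.1) *: tens F (x.2 ++ y.2).

Definition bidegree_part p q j k : F :=
  \sum_(x <- p | size x.2 == j) \sum_(y <- q | size y.2 == k)
    (x.1 * y.1) *: tens F (x.2 ++ y.2).

Lemma dot_tens_cat (a b a' b' : seq H) : size a = size a' -> size b = size b' ->
  (w (size a) ^+ 2 * w (size b) ^+ 2)%:C%C * hdot (tens F (a ++ b)) (tens F (a' ++ b'))
  = (w (size a + size b) ^+ 2)%:C%C * (hdot (tens F a) (tens F a') * hdot (tens F b) (tens F b')).
Proof.
move=> sa sb; rewrite !dot_tens !size_cat sa sb !eqxx zip_cat // big_cat /=.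
rewrite rmorphM /=; ring.
Qed.

(** In a fixed bidegree the unweighted inner product of tensors factors, so the norm is
    multiplicative up to the ratio of the weights. *)
Lemma rnorm_bidegree_part p q j k :
  rnorm (bidegree_part p q j k) =
  w (j + k) * ((w j)^-1 * (w k)^-1) * (rnorm (degree_part p j) * rnorm (degree_part q k)).
Proof.
have wn n : w n != 0 by rewrite gt_eqF.
suff E : (w j ^+ 2 * w k ^+ 2) * rnorm (bidegree_part p q j k) ^+ 2 =
  w (j + k) ^+ 2 * (rnorm (degree_part p j) ^+ 2 * rnorm (degree_part q k) ^+ 2).
  apply/eqP; rewrite -(@eqrXn2 _ 2) ?rnorm_ge0 ?mulr_ge0 ?invr_ge0 ?rnorm_ge0 // ?ltW //.
  apply/eqP; have := congr1 ( *%R (w j ^+ 2 * w k ^+ 2)^-1) E.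
  rewrite mulKf ?mulf_neq0 ?expf_neq0 // => ->.
  by field; rewrite !wn.
suff : (w j ^+ 2 * w k ^+ 2)%:C%C * hdot (bidegree_part p q j k) (bidegree_part p q j k) =
    (w (j + k) ^+ 2)%:C%C * (hdot (degree_part p j) (degree_part p j)
                             * hdot (degree_part q k) (degree_part q k)).
  by rewrite !hdotxxE -!(rmorphM (real_complex R)) => /complexI.
rewrite /bidegree_part /degree_part !hdot_suml big_distrlr /= !mulr_sumr.
apply: eq_bigr => x /eqP sx; rewrite hdot_suml !mulr_sumr.
apply: eq_bigr => y /eqP sy; rewrite !hdot_sumr big_distrlr !mulr_sumr.
apply: eq_bigr => x' /eqP sx'; rewrite hdot_sumr !mulr_sumr.
apply: eq_bigr => y' /eqP sy'; rewrite !hdotZl !hdotZr.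
have := @dot_tens_cat x.2 y.2 x'.2 y'.2 (etrans sx (esym sx')) (etrans sy (esym sy')).
rewrite sx sy rmorphM /= => E.
have -> : (x.1 * y.1)^*%C = x.1^*%C * y.1^*%C by rewrite rmorphM.
move: E; set A := hdot _ _; set B := hdot _ _; set B' := hdot _ _ => E.
transitivity (x.1^*%C * y.1^*%C * x'.1 * y'.1 *
  ((w j ^+ 2)%:C%C * (w k ^+ 2)%:C%C * A)); first by ring.
by rewrite E; ring.
Qed.

Lemma hdot_bidegree_part p q j k j' k' : (j + k != j' + k')%N ->
  hdot (bidegree_part p q j k) (bidegree_part p q j' k') = 0.
Proof.
move=> ne; rewrite /bidegree_part hdot_suml big1 // => x /eqP sx.
rewrite hdot_suml big1 // => y /eqP sy; rewrite hdot_sumr big1 // => x' /eqP sx'.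
rewrite hdot_sumr big1 // => y' /eqP sy'; rewrite hdotZl hdotZr dot_tens.
by rewrite !size_cat sx sy sx' sy' (negbTE ne) !mulr0.
Qed.

Lemma sum_if_eq (V : nmodType) N (k : nat) (v : V) :
  \sum_(i < N) (if k == i :> nat then v else 0) = if (k < N)%N then v else 0.
Proof.
rewrite -big_mkcond; case: ltnP => kN.
  by rewrite (big_pred1 (Ordinal kN)) // => i; rewrite /= -val_eqE /= eq_sym.
by rewrite big1 // => i /eqP ki; move: (ltn_ord i); rewrite -ki ltnNge kN.
Qed.

Lemma combination_degree p N : all (fun x => (size x.2 < N)%N) p ->
  combination (tens F) p = \sum_(k < N) degree_part p k.
Proof.
move=> /allP pN; under eq_bigr => k _ do rewrite /degree_part big_mkcond /=.
rewrite exchange_big /=; apply: eq_big_seq => x /pN xN.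
by rewrite sum_if_eq xN.
Qed.

Lemma rnorm_combination p N : all (fun x => (size x.2 < N)%N) p ->
  rnorm (combination (tens F) p) ^+ 2 = \sum_(k < N) rnorm (degree_part p k) ^+ 2.
Proof.
move=> /combination_degree ->; apply: pythagoras; first exact: index_enum_uniq.
move=> j k jk; rewrite /degree_part hdot_suml big1 // => x /eqP sx.
rewrite hdot_sumr big1 // => y /eqP sy; rewrite hdotZl hdotZr dot_tens.
by rewrite sx sy val_eqE (negbTE jk) !mulr0.
Qed.

Lemma formal_tensor_degree p q N :
  all (fun x => (size x.2 < N)%N) p -> all (fun x => (size x.2 < N)%N) q ->
  formal_tensor p q = \sum_(n < N + N) \sum_(j < n.+1) bidegree_part p q j (n - j)%N.
Proof.
move=> /allP pN /allP qN.
rewrite /bidegree_part.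
under eq_bigr => n _ do under eq_bigr => j _ do rewrite big_mkcond /=.
under eq_bigr => n _ do rewrite exchange_big /=.
rewrite exchange_big /=; apply: eq_big_seq => x /pN xN.
under [RHS]eq_bigr => n _ do under eq_bigr => j _ do rewrite big_mkcond /=.
(* For fixed [x] only [j = size x.2] contributes; the truncated difference [n - j] is exact because
   [j <= n]. *)
have key n : \sum_(j < n.+1) (if size x.2 == j then \sum_(y <- q)
    (if size y.2 == (n - j)%N then (x.1 * y.1) *: tens F (x.2 ++ y.2) else 0) else 0) =
    \sum_(y <- q) (if (size x.2 + size y.2 == n)%N then (x.1 * y.1) *: tens F (x.2 ++ y.2) else 0).
  transitivity (\sum_(j < n.+1) (if size x.2 == j then \sum_(y <- q)
    (if (size x.2 + size y.2 == n)%N then (x.1 * y.1) *: tens F (x.2 ++ y.2) else 0) else 0)).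
    apply: eq_bigr => j _; case: eqP => // ->; apply: eq_bigr => y _.
    by rewrite -(eqn_add2l j) subnKC // -ltnS.
  rewrite sum_if_eq; case: ltnP => // nx.
  by rewrite big1 // => y _; rewrite gtn_eqF // (leq_trans nx) // leq_addr.
under [RHS]eq_bigr => n _ do rewrite key.
rewrite exchange_big /=; apply: eq_big_seq => y /qN yN.
by rewrite sum_if_eq (leq_trans (n := size x.2 + N)) ?ltn_add2l // leq_add2r ltnW.
Qed.

(* Bidegree parts with the same total degree are not orthogonal to each other: they
   are estimated by the triangle and Cauchy-Schwarz inequalities, and only then the
   total degrees are summed orthogonally. *)
Lemma formal_tensor_le (C : R) p q : 
  (forall n, convolution (fun n => w n ^- 2) (fun n => w n ^- 2) n <= C * w n ^- 2) ->
  rnorm (formal_tensor p q) <=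
  Num.sqrt C * rnorm (combination (tens F) p) * rnorm (combination (tens F) q).
Proof.
move=> hC.
have wn n : w n != 0 by rewrite gt_eqF.
have C0 : 0 <= C.
  have w2 : 0 < w 0%N ^- 2 by rewrite invr_gt0 exprn_gt0.
  rewrite -(pmulr_lge0 _ w2) (le_trans _ (hC 0%N)) // /convolution big_ord1.
  by rewrite mulr_ge0 // ltW.
pose N := (\max_(x <- p ++ q) size x.2).+1.
have hN r : {subset r <= p ++ q} -> all (fun x => (size x.2 < N)%N) r.
  by move=> rpq; apply/allP => x /rpq xpq; rewrite ltnS; apply: leq_bigmax_seq.
have pN : all (fun x => (size x.2 < N)%N) p by apply: hN => x xp; rewrite mem_cat xp.
have qN : all (fun x => (size x.2 < N)%N) q by apply: hN => x xq; rewrite mem_cat xq orbT.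
(* Total degrees of the product stay below [N + N], so all three norms are expanded over this
   range. *)
have p2N : all (fun x => (size x.2 < N + N)%N) p.
  by apply: sub_all pN => x /leq_trans; apply; rewrite leq_addr.
have q2N : all (fun x => (size x.2 < N + N)%N) q.
  by apply: sub_all qN => x /leq_trans; apply; rewrite leq_addr.
rewrite -(@ler_pXn2r _ 2) ?nnegrE ?mulr_ge0 ?rnorm_ge0 ?sqrtr_ge0 //.
rewrite !exprMn sqr_sqrtr // (formal_tensor_degree pN qN) pythagoras; last 2 first.
- exact: index_enum_uniq.
- move=> m n mn; rewrite hdot_suml big1 // => j _; rewrite hdot_sumr big1 // => k _.
  by apply: hdot_bidegree_part; rewrite !subnKC // -ltnS.
rewrite (rnorm_combination p2N) (rnorm_combination q2N).
set P := fun k => rnorm (degree_part p k); set Q := fun k => rnorm (degree_part q k).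
(* It suffices to bound each total degree by [C] times the convolution of the squared norms, whose
   sum is at most the product of the sums. *)
rewrite -mulrA; apply: (@le_trans _ _ (\sum_(n < N + N)
    C * convolution (fun k => P k ^+ 2) (fun k => Q k ^+ 2) n)); last first.
  rewrite -mulr_sumr ler_wpM2l //; apply: sum_convolution_le => k; exact: sqr_ge0.
apply: ler_sum => n _; set v := fun k => (w k)^-1.
have h : rnorm (\sum_(j < n.+1) bidegree_part p q j (n - j)%N) <=
    w n * \sum_(j < n.+1) (v j * v (n - j)%N) * (P j * Q (n - j)%N).
  rewrite mulr_sumr (le_trans (rnorm_sum _ _ _))//; apply: ler_sum => j _.
  by rewrite rnorm_bidegree_part subnKC ?mulrA // -ltnS.
have h0 : 0 <= w n * \sum_(j < n.+1) (v j * v (n - j)%N) * (P j * Q (n - j)%N).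
  exact: le_trans (rnorm_ge0 _) h.
apply: (@le_trans _ _ ((w n * \sum_(j < n.+1) (v j * v (n - j)%N) * (P j * Q (n - j)%N)) ^+ 2)).
  by apply: lerXn2r; rewrite ?nnegrE ?rnorm_ge0.
rewrite exprMn.
(* Cauchy-Schwarz separates weights from norms; the squared weights sum to the convolution that [hC]
   bounds. *)
have := @sum_cauchy_schwarz R n.+1 (fun j => v j * v (n - j)%N) (fun j => P j * Q (n - j)%N).
rewrite /convolution.
under [X in _ <= X * _ -> _]eq_bigr => j _ do rewrite exprMn.
under [X in _ <= _ * X -> _]eq_bigr => j _ do rewrite exprMn.
have := hC n; rewrite /convolution.
have -> : \sum_(k < n.+1) w k ^- 2 * w (n - k) ^- 2 = \sum_(j < n.+1) v j ^+ 2 * v (n - j)%N ^+ 2.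
  by apply: eq_bigr => j _; rewrite /v !exprVn.
set S := \sum_(j < _) v j ^+ 2 * _; set T := \sum_(j < _) P j ^+ 2 * _.
set U := (\sum_(j < _) _) ^+ 2 => hS hU.
have T0 : 0 <= T by apply: sumr_ge0 => j _; rewrite mulr_ge0 ?sqr_ge0.
have w2 : 0 < w n ^+ 2 by rewrite exprn_gt0.
apply: (@le_trans _ _ (w n ^+ 2 * (S * T))); first by rewrite ler_pM2l.
apply: (@le_trans _ _ (w n ^+ 2 * ((C * w n ^- 2) * T))).
  by rewrite ler_pM2l // ler_wpM2r.
by rewrite mulrA [C * _]mulrC mulrA divff ?mul1r // gt_eqF.
Qed.

End TensorProduct.

(** * Bounded linear maps and existence of the tensor product *)

Definition bounded_linear (R : realType) (V W : normedModType R[i]) (L : V -> W) :=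
  (forall a x y, L (a *: x + y) = a *: L x + L y) /\
  exists M : R, forall x, rnorm (L x) <= M * rnorm x.

Section BoundedLinear.
Variables (R : realType) (V W : normedModType R[i]).

Lemma bounded_linear_combine a (L L' : V -> W) :
  bounded_linear L -> bounded_linear L' -> bounded_linear (fun x => a *: L x + L' x).
Proof.
move=> [lL [M bL]] [lL' [M' bL']]; split=> [c x y|].
  rewrite lL lL' !scalerDr !scalerA addrACA; congr (_ + _ + _).
  by rewrite mulrC.
exists (cabs a * M + M') => x; rewrite (le_trans (rnormD _ _))// mulrDl lerD //.
by rewrite rnormZ -mulrA ler_wpM2l ?cabs_ge0.
Qed.

Lemma bounded_linear_combination (T : Type) (L : T -> V -> W) p :
  (forall t, bounded_linear (L t)) ->
  bounded_linear (fun x => combination (fun t => L t x) p).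
Proof.
move=> bL; elim: p => [|c p IH].
  split=> [a x y|]; first by rewrite /combination !big_nil scaler0 addr0.
  by exists 0 => x; rewrite /combination big_nil rnorm0 mul0r.
rewrite (_ : (fun x => _) = fun x => c.1 *: L c.2 x + combination (fun t => L t x) p).
  exact: bounded_linear_combine.
by apply/funext => x; rewrite /combination big_cons.
Qed.

End BoundedLinear.

(** Pairing the difference of the maps with its own value at [x] reduces equality of vectors to a
    scalar functional vanishing on elementary tensors. *)
Lemma fock_ext (R : realType) (H H' : hilbertType R) (w : nat -> R)
    (F : fock_space H w) (L L' : F -> H') :
  bounded_linear L -> bounded_linear L' ->
  (forall u, L (tens F u) = L' (tens F u)) -> L =1 L'.
Proof.
move=> bL bL' LL' x.
have [lD [M bD]] := bounded_linear_combine (-1) bL bL'.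
pose y := -1 *: L x + L' x.
suff /eqP : hdot y y = 0.
  rewrite hdotxxE fmorph_eq0 expf_eq0 /= => /eqP/rnorm_eq0.
  by rewrite /y scaleN1r addrC => /eqP; rewrite subr_eq0 => /eqP.
apply: (@fock_eq0 _ _ _ F (fun z => hdot y (-1 *: L z + L' z)) (rnorm y * M)).
- by move=> a z z'; rewrite lD hdotDr hdotZr.
- by move=> z; rewrite (le_trans (cauchy_schwarz _ _))// -mulrA ler_wpM2l ?rnorm_ge0.
- by move=> u; rewrite LL' scaleN1r addNr hdot0r.
Qed.

(** The product is extended one variable at a time: first to all right factors for a formal left
    factor, then to all left factors for a fixed right factor. *)
Lemma tensor_product_ex (R : realType) (H : hilbertType R) (w : nat -> R)
    (F : fock_space H w) :
  (forall n, 0 < w n) -> subconvolutive (fun n => w n ^- 2) ->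
  exists m, is_tensor_product (F := F) m.
Proof.
move=> w_gt0 [C hC].
have M0 : 0 <= Num.sqrt C by apply: sqrtr_ge0.
have dense := @fock_dense _ _ _ F.
have /choice[L hL] : forall p, exists L : F -> F,
    [/\ forall a x y, L (a *: x + y) = a *: L x + L y,
        forall x, rnorm (L x) <= Num.sqrt C * rnorm (combination (tens F) p) * rnorm x &
        forall v, L (tens F v) = combination (fun u => tens F (u ++ v)) p].
  move=> p; pose e' v := combination (fun u => tens F (u ++ v)) p.
  have [||L [lL bL cL]] := @bounded_extension _ _ _ _ (tens F) e'
      (Num.sqrt C * rnorm (combination (tens F) p)) _ dense _.
  - by rewrite mulr_ge0 ?rnorm_ge0.
  - move=> q; rewrite (_ : combination e' q = formal_tensor F p q).
      exact: formal_tensor_le.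
    rewrite /combination /e' /combination /formal_tensor exchange_big /=.
    apply: eq_bigr => y _; rewrite scaler_sumr; apply: eq_bigr => x _.
    by rewrite scalerA mulrC.
  - by exists L; split => // v; rewrite -{1}(combination1 (tens F) v) cL combination1.
have bL p : bounded_linear (L p).
  by have [lL bL _] := hL p; split => //; eexists; exact: bL.
pose L1 u := L [:: (1, u)].
(* Linearity of [L p g] in the list [p] turns the bound on [L p] into the comparison required by the
   second extension. *)
have LE p g : L p g = combination (fun u => L1 u g) p.
  apply: (@fock_ext _ _ _ _ F (L p) (fun g => combination (L1^~ g) p) (bL p)) => [|v].
    by apply: bounded_linear_combination => u; apply: bL.
  have [_ _ ->] := hL p; apply: eq_bigr => x _; rewrite /L1.
  by have [_ _ ->] := hL [:: (1, x.2)]; rewrite combination1.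
have /choice[m hm] : forall g, exists m : F -> F,
    [/\ forall a x y, m (a *: x + y) = a *: m x + m y,
        forall x, rnorm (m x) <= Num.sqrt C * rnorm g * rnorm x &
        forall u, m (tens F u) = L1 u g].
  move=> g.
  have [||m [lm bm cm]] := @bounded_extension _ _ _ _ (tens F) (fun u => L1 u g)
      (Num.sqrt C * rnorm g) _ dense _.
  - by rewrite mulr_ge0 ?rnorm_ge0.
  - by move=> p; rewrite -LE; have [_ /(_ g) + _] := hL p; rewrite mulrAC.
  - by exists m; split => // u; rewrite -{1}(combination1 (tens F) u) cm combination1.
have bm g : bounded_linear (m g).
  by have [lm bm _] := hm g; split => //; eexists; exact: bm.
exists (fun f g => m g f); split.
- by move=> a f f' g; have [-> _ _] := hm g.
(* Linearity in [g] is not built into the choice of [m g], so it is checked on elementary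
   tensors. *)
- move=> a f g g'; apply: (@fock_ext _ _ _ _ F _ (fun f => a *: m g f + m g' f) (bm (a *: g + g'))).
    exact: bounded_linear_combine.
  move=> u; have [_ _ ->] := hm (a *: g + g'); have [_ _ ->] := hm g.
  by have [_ _ ->] := hm g'; rewrite /L1; have [-> _ _] := hL [:: (1, u)].
- exists (Num.sqrt C) => f g; rewrite !hnormE mulrAC.
  by have [_ + _] := hm g; apply.
- move=> u v; have [_ _ ->] := hm (tens F v); rewrite /L1; have [_ _ ->] := hL [:: (1, u)].
  by rewrite combination1.
Qed.

Lemma ftensP (R : realType) (H : hilbertType R) (w : nat -> R)
    (F : fock_space H w) :
  (forall n, 0 < w n) -> subconvolutive (fun n => w n ^- 2) ->
  is_tensor_product (ftens F).
Proof.
move=> w_gt0 w_sub; have [m hm] := tensor_product_ex F w_gt0 w_sub.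
by rewrite /ftens; case: xgetP => [m' _ //|/(_ m)].
Qed.

(** * The weighted power series up to the radius of convergence *)

Section WeightRadius.
Variables (R : realType) (w : nat -> R) (C : R).
Hypothesis w_gt0 : forall n, 0 < w n.
Hypothesis hC : forall n,
  convolution (fun n => w n ^- 2) (fun n => w n ^- 2) n <= C * w n ^- 2.
Implicit Types r t : R.

Definition weight_sum r N := \sum_(n < N) w n ^- 2 * r ^+ (2 * n).

Lemma inv_weight_gt0 n : 0 < w n ^- 2.
Proof. by rewrite invr_gt0 exprn_gt0. Qed.

Lemma weight_term_ge0 r n : 0 <= w n ^- 2 * r ^+ (2 * n).
Proof. by rewrite mulr_ge0 ?(ltW (inv_weight_gt0 _)) // exprM exprn_ge0 // sqr_ge0. Qed.

(** The square is a polynomial in [r ^+ 2] whose coefficients are truncated convolutions of [w^-2],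
    each dominated by subconvolutivity. *)
Lemma weight_sum_sqr r N : weight_sum r N ^+ 2 <= C * weight_sum r (N + N).
Proof.
pose p := \poly_(n < N) w n ^- 2.
have -> : weight_sum r N ^+ 2 = (p * p).[r ^+ 2].
  rewrite hornerM -expr2 horner_poly; congr (_ ^+ 2); apply: eq_bigr => n _.
  by rewrite exprM.
have sp : (size (p * p)%R <= N + N)%N.
  rewrite (leq_trans (size_polyMleq _ _))// (leq_trans (leq_pred _))//.
  by rewrite leq_add ?size_poly.
rewrite (horner_coef_wide _ sp) mulr_sumr; apply: ler_sum => n _.
rewrite -exprM mulrA; apply: ler_wpM2r; first by rewrite exprM exprn_ge0 ?sqr_ge0.
rewrite coefM (le_trans _ (hC n))//.
apply: ler_sum => j _; rewrite !coef_poly.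
have pos := fun n => ltW (inv_weight_gt0 n).
by case: ifP; case: ifP; rewrite ?mul0r ?mulr0 ?mulr_ge0.
Qed.

(** The full sum [S] satisfies [S^2 <= C S], and [S > 0] because of its first term; hence
    [S <= C]. *)
Lemma weight_sum_cvg_le r N :
  cvgn (series (fun n => w n ^- 2 * r ^+ (2 * n))) -> weight_sum r N <= C.
Proof.
set u := series _ => cu.
have uE n : u n = weight_sum r n by rewrite /u seriesEord.
have nu : nondecreasing_seq u.
  apply/nondecreasing_seqP => n; rewrite !uE /weight_sum big_ord_recr /= lerDl.
  exact: weight_term_ge0.
have ul n : u n <= limn u by exact: nondecreasing_cvgn_le.
have l0 : 0 < limn u.
  apply: lt_le_trans (ul 1%N); rewrite uE /weight_sum big_ord1 muln0 mulr1.
  exact: inv_weight_gt0.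
suff lC : limn u <= C by rewrite -uE (le_trans (ul N)).
have C0 : 0 <= C.
  rewrite -(pmulr_lge0 _ (inv_weight_gt0 0%N)) (le_trans _ (hC 0%N)) //.
  by rewrite /convolution big_ord1 mulr_ge0 // ltW // inv_weight_gt0.
have : limn u <= Num.sqrt (C * limn u).
  apply: limr_le => //; apply: nearW => n.
  rewrite -(@ler_pXn2r _ 2) ?nnegrE ?sqrtr_ge0 //; last first.
    by rewrite uE; apply: sumr_ge0 => i _; apply: weight_term_ge0.
  rewrite sqr_sqrtr ?mulr_ge0 ?(ltW l0) // uE (le_trans (weight_sum_sqr _ _))//.
  by rewrite -uE ler_wpM2l.
rewrite -(@ler_pXn2r _ 2) ?nnegrE ?sqrtr_ge0 ?(ltW l0) //.
by rewrite sqr_sqrtr ?mulr_ge0 ?(ltW l0) // expr2 ler_pM2r.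
Qed.

Lemma bernoulli_le t m : 0 <= t -> t <= 1 -> 1 - m%:R * t <= (1 - t) ^+ m.
Proof.
move=> t0 t1; elim: m => [|m IH]; first by rewrite mul0r subr0.
have : (1 - m%:R * t) * (1 - t) <= (1 - t) ^+ m * (1 - t).
  by rewrite ler_wpM2r // subr_ge0.
rewrite exprSr -natr1; have : 0 <= m%:R * t ^+ 2 by rewrite mulr_ge0 ?sqr_ge0.
by move: (m%:R) ((1 - t) ^+ m * _) => a b; nra.
Qed.

(** Strictly inside the radius of convergence the bound [C] does not depend on the point. It reaches
    the boundary by scaling [r] by [1 - t] and letting [t] tend to 0 in the finite sum, with
    Bernoulli's inequality measuring the loss. *)
Lemma weight_sum_radius_le r N : 0 <= r -> (r%:E <= weight_radius w)%E ->
  weight_sum r N <= C.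
Proof.
move=> r0 rR.
have below t : 0 < t -> t < 1 -> (1 - t) ^+ (2 * N) * weight_sum r N <= C.
  move=> t0 t1.
  have t1' : 0 <= 1 - t by rewrite subr_ge0 ltW.
  have lowr : (1 - t) ^+ (2 * N) * weight_sum r N <= weight_sum ((1 - t) * r) N.
    rewrite /weight_sum mulr_sumr; apply: ler_sum => n _.
    rewrite exprMn mulrCA ler_wpM2l ?(ltW (inv_weight_gt0 _)) //.
    rewrite ler_wpM2r ?exprn_ge0 // ler_wiXn2l ?lerBlDr ?lerDl ?(ltW t0) //.
    by rewrite leq_mul2l ltnW.
  apply: (le_trans lowr).
  (* For [r = 0] the scaled point is not strictly smaller; there only the term of degree 0
     survives. *)
  have [r00|rpos] := eqVneq r 0.
    apply: weight_sum_cvg_le; rewrite r00 mulr0.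
    apply: (cvgP (w 0%N ^- 2)); apply/cvgrPdist_lt => e e0; exists 1%N => // n /= n1.
    rewrite seriesEord /= (bigD1 (Ordinal n1)) //= expr0 mulr1 big1 ?addr0 ?subrr ?normr0 //.
    by move=> i; rewrite -val_eqE /= expr0n muln_eq0 /= => /negbTE ->; rewrite mulr0.
  have rgt : 0 < r by rewrite lt_neqAle eq_sym rpos.
  have /ereal_sup_gt[_ [s [s0 cs] <-]] : (((1 - t) * r)%:E < weight_radius w)%E.
    by apply: lt_le_trans rR; rewrite lte_fin gtr_pMl // ltrBlDr ltrDl.
  rewrite lte_fin => rs; apply: le_trans (weight_sum_cvg_le N cs).
  apply: ler_sum => n _; rewrite ler_wpM2l ?(ltW (inv_weight_gt0 _)) //.
  by apply: lerXn2r; rewrite ?nnegrE ?mulr_ge0 // ltW.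
have S0 : 0 <= weight_sum r N by apply: sumr_ge0 => n _; apply: weight_term_ge0.
apply/ler_addgt0Pr => e e0.
have mS : 0 <= (2 * N)%:R * weight_sum r N by rewrite mulr_ge0.
(* By Bernoulli the loss is at most [2 N t] times the sum, which this [t] keeps below [e]; the cap
   1/2 ensures [t < 1]. *)
pose t := Num.min 2%:R^-1 (e / ((2 * N)%:R * weight_sum r N + 1)).
have t0 : 0 < t by rewrite lt_min invr_gt0 ltr0n divr_gt0 // ltr_wpDl.
have t1 : t < 1 by rewrite gt_min invf_lt1 // ltr1n.
have te : t * ((2 * N)%:R * weight_sum r N + 1) <= e.
  by rewrite -ler_pdivlMr ?ltr_wpDl // ge_min lexx orbT.
have := below t t0 t1.
have := bernoulli_le (2 * N) (ltW t0) (ltW t1).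
move=> /(ler_wpM2r S0) /le_trans h /h {h}.
nra.
Qed.

End WeightRadius.

(** * Convergence of dominated series and of Neumann series *)

(** The exponent [p] covers two uses: [p = 1] for norm-summable terms and [p = 2] for orthogonal
    terms, whose squared norms add up. *)
Lemma dominated_series_cvg (R : realType) (V : completeNormedModType R[i])
    (v : nat -> V) (b : nat -> R) (p : nat) (C : R) :
  (0 < p)%N -> (forall k, 0 <= b k) -> (forall n, \sum_(0 <= k < n) b k <= C) ->
  (forall m n, rnorm (\sum_(m <= k < n) v k) ^+ p <= \sum_(m <= k < n) b k) ->
  exists l : V, series v @ \oo --> l.
Proof.
move=> p0 b0 bC vb.
have ns : nondecreasing_seq (series b).
  by apply/nondecreasing_seqP => n; rewrite /series /= big_nat_recr //= lerDl.
have cs : cvgn (series b).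
  by apply: nondecreasing_is_cvgn => //; exists C => _ [n _ <-]; apply: bC.
have sl n : series b n <= limn (series b) by apply: nondecreasing_cvgn_le.
apply: rnorm_complete => e e0; have ep : 0 < e ^+ p by rewrite exprn_gt0.
move/cvgrPdist_lt: cs => /(_ _ ep)[N _ hN].
have dist m n : (N <= m)%N -> (m <= n)%N -> rnorm (series v n - series v m) < e.
  move=> Nm mn; rewrite sub_series_geq //.
  rewrite -(@ltr_pXn2r _ p) ?nnegrE ?rnorm_ge0 ?(ltW e0) // (le_lt_trans (vb _ _))//.
  rewrite -sub_series_geq //; have := hN m Nm; rewrite /= ger0_norm ?subr_ge0 //.
  by apply: le_lt_trans; rewrite lerD2r.
exists N => m n Nm Nn; have [mn|nm] := leqP m n; last exact: dist (ltnW nm).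
by rewrite rdistC; apply: dist.
Qed.

(** The solution is the sum of the iterates of [A] at [f]; the shift relation [vS] between partial
    sums passes to the limit. *)
Lemma neumann_fixed_point (R : realType) (V : completeNormedModType R[i]) (A : V -> V) (q : R)
    (f : V) :
  (forall a x y, A (a *: x + y) = a *: A x + A y) ->
  0 <= q -> q < 1 -> (forall x, rnorm (A x) <= q * rnorm x) ->
  exists g, g = f + A g.
Proof.
move=> lA q0 q1 bA.
have AD x y : A (x + y) = A x + A y by have := lA 1 x y; rewrite !scale1r.
have A0 : A 0 = 0 by apply: (addrI (A 0)); rewrite -AD !addr0.
have AB x y : A (x - y) = A x - A y.
  rewrite AD -scaleN1r; have := lA (-1) y 0.
  by rewrite !addr0 A0 addr0 => ->; rewrite scaleN1r.
pose v k := iter k A f.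
have q1' : 0 < 1 - q by rewrite subr_gt0.
have vq k : rnorm (v k) <= q ^+ k * rnorm f.
  elim: k => [|k IH]; first by rewrite expr0 mul1r.
  by rewrite exprS -mulrA (le_trans (bA _))// ler_wpM2l.
have [||||g hg] := @dominated_series_cvg _ _ v (fun k => q ^+ k * rnorm f) 1
    (rnorm f / (1 - q)).
- by [].
- by move=> k; rewrite mulr_ge0 ?exprn_ge0 ?rnorm_ge0.
- move=> n; rewrite -mulr_suml mulrC ler_wpM2l ?rnorm_ge0 // big_mkord.
  rewrite -[leRHS]mul1r ler_pdivlMr // mulrC -opprB mulNr -subrX1 opprB.
  by rewrite lerBlDr lerDl exprn_ge0.
- by move=> m n; rewrite expr1 (le_trans (rnorm_sum _ _ _))//; apply: ler_sum.
have vS n : series v n.+1 = f + A (series v n).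
  rewrite !seriesEord /= big_ord_recl; congr (_ + _).
  have -> : A (\sum_(k < n) v k) = \sum_(k < n) A (v k).
    by elim/big_rec2: _ => [|i y x _ <-]; rewrite ?A0 ?AD.
  by apply: eq_bigr.
exists g; apply/eqP; rewrite -subr_eq0; apply/eqP/rnorm_eq0/eqP.
rewrite eq_le rnorm_ge0 andbT; apply/ler_addgt0Pr => e e0; rewrite add0r.
have e2 : 0 < e / 2 by rewrite divr_gt0.
move/cvg_rnormP: hg => /(_ _ e2)[N hN].
rewrite (le_trans (rdistD (series v N.+1) _ _))// [leRHS]splitr.
apply: lerD; first by rewrite ltW // hN.
rewrite vS opprD addrACA subrr add0r -AB (le_trans (bA _))//.
rewrite (@le_trans _ _ (1 * rnorm (series v N - g)))//.
  by apply: ler_wpM2r; rewrite ?rnorm_ge0 // ltW.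
by rewrite mul1r rdistC ltW // hN.
Qed.

(** * Multilinearity of elementary tensors *)

Section Multilinear.
Variables (R : realType) (H : hilbertType R) (w : nat -> R) (F : fock_space H w).
Implicit Types (u v : seq H) (x : H).

Lemma tens0 u v : tens F (u ++ 0 :: v) = 0.
Proof.
have := tens_linear F u v 1 0 0; rewrite scaler0 addr0 scale1r => E.
by apply: (addrI (tens F (u ++ 0 :: v))); rewrite -E addr0.
Qed.

Lemma tensZ u v a x : tens F (u ++ (a *: x) :: v) = a *: tens F (u ++ x :: v).
Proof. by have := tens_linear F u v a x 0; rewrite tens0 !addr0. Qed.

Lemma tens_sum (I : Type) (r : seq I) (P : pred I) (f : I -> H) u v :
  tens F (u ++ (\sum_(i <- r | P i) f i) :: v) =
  \sum_(i <- r | P i) tens F (u ++ f i :: v).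
Proof.
elim/big_rec2: _ => [|i y x _ <-]; first exact: tens0.
by have := tens_linear F u v 1 (f i) x; rewrite !scale1r.
Qed.

Lemma tens_nseqZ u a x n :
  tens F (u ++ nseq n (a *: x)) = a ^+ n *: tens F (u ++ nseq n x).
Proof.
elim: n u => [|n IH] u; first by rewrite expr0 scale1r.
rewrite /= tensZ -cat_rcons IH cat_rcons scalerA.
by rewrite -exprS.
Qed.

Lemma dot_tens_nseq n x v :
  hdot (tens F (nseq n x)) (tens F v) =
  if n == size v then (w n ^+ 2)%:C%C * \prod_(y <- v) hdot x y else 0.
Proof.
rewrite dot_tens size_nseq; case: eqP => // ->; congr (_ * _).
by elim: v => [|y v IH]; rewrite ?big_nil //= !big_cons IH.
Qed.

End Multilinear.

(** * Kernel vectors and characters *)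

Section KernelVectors.
Variables (R : realType) (H : hilbertType R) (w : nat -> R) (F : fock_space H w).
Hypothesis w_gt0 : forall n, 0 < w n.
Hypothesis w_sub : subconvolutive (fun n => w n ^- 2).
Implicit Types (eta : H) (v : seq H).

Definition in_ball (w : nat -> R) eta := ((hnorm eta)%:E <= weight_radius w)%E.

Definition kernel_term eta n : F := (w n ^- 2)%:C%C *: tens F (nseq n eta).

Lemma kernel_termZ a eta n : kernel_term (a *: eta) n = a ^+ n *: kernel_term eta n.
Proof.
by rewrite /kernel_term (tens_nseqZ F [::]) !scalerA mulrC.
Qed.

Lemma rnorm_kernel_term eta n :
  rnorm (kernel_term eta n) ^+ 2 = w n ^- 2 * rnorm eta ^+ (2 * n).
Proof.
have wn : w n != 0 by rewrite gt_eqF.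
apply: complexI; rewrite -hdotxxE hdotZr hdotZl dot_tens_nseq size_nseq eqxx.
rewrite conjc_real big_nseq iter_mulr_1 hdotxxE -rmorphXn -!rmorphM /=; congr _%:C%C.
by rewrite exprM; field.
Qed.

Lemma kernel_term_orth eta m n : m != n ->
  hdot (kernel_term eta m) (kernel_term eta n) = 0.
Proof.
move=> mn; rewrite hdotZr hdotZl dot_tens_nseq size_nseq (negbTE mn).
by rewrite !mulr0.
Qed.

Lemma rnorm_kernel_sum (c : nat -> R[i]) eta m n :
  rnorm (\sum_(m <= k < n) c k *: kernel_term eta k) ^+ 2 =
  \sum_(m <= k < n) cabs (c k) ^+ 2 * (w k ^- 2 * rnorm eta ^+ (2 * k)).
Proof.
rewrite pythagoras ?iota_uniq // => [|i j ij]; last first.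
  by rewrite hdotZr hdotZl kernel_term_orth // !mulr0.
by apply: eq_bigr => k _; rewrite rnormZ exprMn rnorm_kernel_term.
Qed.

Lemma ball_sum_le eta : in_ball w eta ->
  exists C : R, forall m n, \sum_(m <= k < n) w k ^- 2 * rnorm eta ^+ (2 * k) <= C.
Proof.
move=> eB; have [C hC] := w_sub; exists C => m n.
apply: le_trans (weight_sum_radius_le w_gt0 hC n (rnorm_ge0 eta) eB).
rewrite /weight_sum -(big_mkord xpredT (fun k => w k ^- 2 * rnorm eta ^+ (2 * k))).
have pos k : 0 <= w k ^- 2 * rnorm eta ^+ (2 * k) by apply: weight_term_ge0.
have [mn|nm] := leqP m n; last first.
  by rewrite [X in X <= _]big_geq ?(ltnW nm) //; apply: sumr_ge0.
by rewrite [leRHS](@big_cat_nat _ _ _ m) //= lerDr sumr_ge0.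
Qed.

(** [kernel_vector] is a [limn], hence a genuine sum only once convergence is known. The terms are
    orthogonal, and the bound on their squared norms includes the boundary of the ball. *)
Lemma ball_cvg eta : in_ball w eta ->
  series (kernel_term eta) @ \oo --> kernel_vector F eta.
Proof.
move=> /ball_sum_le[C hC].
have [||||l hl] := @dominated_series_cvg R F (kernel_term eta)
    (fun k => w k ^- 2 * rnorm eta ^+ (2 * k)) 2 C; last first.
  by rewrite /kernel_vector (_ : limn _ = l) //; apply: cvg_lim.
- move=> m n; have := rnorm_kernel_sum (fun=> 1) eta m n.
  under eq_bigr => k _ do rewrite scale1r.
  move=> ->; apply: ler_sum => k _.
  by rewrite /cabs normr1 expr1n mul1r.
- by [].
- by move=> k; apply: weight_term_ge0.
- by [].
Qed.

(** The coefficient [w^-2] cancels the weight in the inner product, and only the term of degree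
    [size v] is not orthogonal by degree. *)
Lemma hdot_kernel_sum eta v n : (size v < n)%N ->
  hdot (series (kernel_term eta) n) (tens F v) = \prod_(x <- v) hdot eta x.
Proof.
move=> vn; rewrite seriesEord /= hdot_suml (bigD1 (Ordinal vn)) //= big1 => [|k kv].
  rewrite addr0 hdotZl dot_tens_nseq eqxx conjc_real mulrA -rmorphM /=.
  by rewrite mulVf ?mul1r // expf_neq0 // gt_eqF.
rewrite hdotZl dot_tens_nseq; case: eqP => [kE|]; last by rewrite mulr0.
by move: kv; rewrite -val_eqE /= kE eqxx.
Qed.

Lemma hdot_kernel_tens eta v : in_ball w eta ->
  hdot (kernel_vector F eta) (tens F v) = \prod_(x <- v) hdot eta x.
Proof.
move=> /ball_cvg eB; rewrite hdotC -[RHS]conjcK; congr (_ ^*)%C.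
apply: (hdot_lim_eq (x := tens F v) eB); exists (size v).+1 => n vn.
by rewrite hdotC hdot_kernel_sum.
Qed.

Lemma tensorP : is_tensor_product (ftens F).
Proof. exact: ftensP. Qed.

Lemma ftensDl f f' g a : ftens F (a *: f + f') g = a *: ftens F f g + ftens F f' g.
Proof. by have [-> _ _ _] := tensorP. Qed.

Lemma ftensDr f g g' a : ftens F f (a *: g + g') = a *: ftens F f g + ftens F f g'.
Proof. by have [_ -> _ _] := tensorP. Qed.

Lemma ftens_tens a b : ftens F (tens F a) (tens F b) = tens F (a ++ b).
Proof. by have [_ _ _ ->] := tensorP. Qed.

Lemma ftens_bound : exists2 M : R, 0 < M &
  forall f g, rnorm (ftens F f g) <= M * rnorm f * rnorm g.
Proof.
have [_ _ [M hM] _] := tensorP; exists (`|M| + 1); first by rewrite ltr_wpDl.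
move=> f g; apply: le_trans (hM f g) _; rewrite !hnormE -!mulrA.
by apply: ler_wpM2r; rewrite ?mulr_ge0 ?rnorm_ge0 // ler_wpDr // ler_norm.
Qed.

Lemma ftens_eq0_ext (D : F -> F -> R[i]) (K : R) :
  (forall a f f' g, D (a *: f + f') g = a * D f g + D f' g) ->
  (forall a f g g', D f (a *: g + g') = a * D f g + D f g') ->
  (forall f g, cabs (D f g) <= K * rnorm f * rnorm g) ->
  (forall a b, D (tens F a) (tens F b) = 0) -> forall f g, D f g = 0.
Proof.
move=> Dl Dr Db Dt f g.
apply: (@fock_eq0 _ _ _ F (fun f => D f g) (K * rnorm g)) => [a x y|x|u].
- exact: Dl.
- by rewrite mulrAC.
- apply: (@fock_eq0 _ _ _ F (fun g => D (tens F u) g) (K * rnorm (tens F u))) => //.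
Qed.

(** The defect of multiplicativity is a bounded bilinear form, so it is determined on pairs of
    elementary tensors. *)
Lemma multiplicative_ext xi :
  (forall a b, hdot xi (tens F (a ++ b)) = hdot xi (tens F a) * hdot xi (tens F b)) ->
  forall f g, hdot xi (ftens F f g) = hdot xi f * hdot xi g.
Proof.
move=> xit f g; apply/eqP; rewrite -subr_eq0; apply/eqP.
have [M M0 hM] := ftens_bound.
pose D f g := hdot xi (ftens F f g) - hdot xi f * hdot xi g.
apply: (@ftens_eq0_ext D (rnorm xi * M + rnorm xi * rnorm xi)) => {f g}.
- by move=> a f f' g; rewrite /D ftensDl !hdotDr !hdotZr; ring.
- by move=> a f g g'; rewrite /D ftensDr !hdotDr !hdotZr; ring.
- move=> f g; rewrite /D (le_trans (cabsD _ _))// cabsN cabsM.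
  have h1 := cauchy_schwarz xi (ftens F f g).
  have h2 := ler_wpM2l (rnorm_ge0 xi) (hM f g).
  have h3 := ler_pM (cabs_ge0 _) (cabs_ge0 _) (cauchy_schwarz xi f) (cauchy_schwarz xi g).
  rewrite (le_trans (lerD (le_trans h1 h2) h3))// le_eqVlt; apply/orP; left; apply/eqP.
  ring.
- by move=> a b; rewrite /D ftens_tens xit subrr.
Qed.

Lemma kernel_spectrum eta : in_ball w eta ->
  spectrum (full_algebra F) (hdot (kernel_vector F eta)).
Proof.
move=> eB; split => /=.
- by move=> x y _ _; rewrite hdotDr.
- by move=> a x _; rewrite hdotZr.
- move=> x y _ _; apply: multiplicative_ext => a b.
  by rewrite !hdot_kernel_tens // big_cat.
- by exists (tens F [::]) => //; rewrite hdot_kernel_tens // big_nil oner_neq0.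
Qed.

Lemma character_bounded chi : spectrum (full_algebra F) chi ->
  exists M : R, forall f, cabs (chi f) <= M * rnorm f.
Proof.
move=> [chiD chiZ chiM _]; rewrite /= in chiD chiZ chiM.
have [M M0 hM] := ftens_bound; exists M => f; rewrite leNgt; apply/negP => lt.
have cf : chi f != 0.
  apply/eqP => cf; move: lt; rewrite cf cabs0 ltNge mulr_ge0 ?rnorm_ge0 //.
  exact: ltW.
have cf0 : 0 < cabs (chi f) by apply: le_lt_trans lt; rewrite mulr_ge0 ?rnorm_ge0 // ltW.
pose f1 := (chi f)^-1 *: f.
have cf1 : chi f1 = 1 by rewrite chiZ // mulVf.
have q1 : M * rnorm f1 < 1.
  by rewrite rnormZ cabsV mulrCA mulrC ltr_pdivrMr // mul1r.
(* a fixed point g of g |-> f1 + f1 (x) g would satisfy chi g = 1 + chi g *)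
suff [g hg] : exists g, g = f1 + ftens F f1 g.
  have := congr1 chi hg; rewrite chiD // chiM // cf1 mul1r => /eqP.
  by rewrite -[X in X == _]add0r (inj_eq (addIr _)) eq_sym oner_eq0.
apply: (@neumann_fixed_point _ _ (ftens F f1) (M * rnorm f1)) => //.
- by move=> a x y; rewrite ftensDr.
- by rewrite mulr_ge0 ?rnorm_ge0 // ltW.
Qed.

Lemma character_kernel chi : spectrum (full_algebra F) chi ->
  exists2 eta, in_ball w eta & forall f, chi f = hdot (kernel_vector F eta) f.
Proof.
move=> hchi; have [M hM] := character_bounded hchi.
move: hchi => [chiD chiZ chiM [f0 _ cf0]]; rewrite /= in chiD chiZ chiM.
have lchi a x y : chi (a *: x + y) = a * chi x + chi y by rewrite chiD // chiZ.
have [xi hxi] := riesz lchi hM.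
have chicat a b : chi (tens F (a ++ b)) = chi (tens F a) * chi (tens F b).
  by rewrite -ftens_tens chiM.
(* The value at the unit is idempotent; if it were 0, [chi] would vanish on all elementary tensors
   and so everywhere. *)
have chi1 : chi (tens F [::]) = 1.
  have [c0|c0] := eqVneq (chi (tens F [::])) 0; last first.
    by apply: (mulfI c0); rewrite -chicat mulr1.
  have : chi f0 = 0.
    apply: (@fock_eq0 _ _ _ F chi M) => // u.
    by have := chicat [::] u; rewrite /= c0 mul0r.
  by move=> E; rewrite E eqxx in cf0.
have [eta heta] : exists eta, forall x, chi (tens F [:: x]) = hdot eta x.
  apply: (@riesz _ _ _ (`|M| * w 1%N)) => [a x y|x].
    by have /= -> := tens_linear F [::] [::] a x y; rewrite lchi.
  apply: le_trans (hM _) _.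
  suff -> : rnorm (tens F [:: x]) = w 1%N * rnorm x.
    rewrite mulrA; apply: ler_wpM2r; first exact: rnorm_ge0.
    by apply: ler_wpM2r; rewrite ?ler_norm // ltW.
  apply/eqP; rewrite -(@eqrXn2 _ 2) ?rnorm_ge0 ?mulr_ge0 ?rnorm_ge0 // ?ltW //.
  apply/eqP/complexI; rewrite -hdotxxE dot_tens /= big_seq1 /= hdotxxE -rmorphM /=.
  by rewrite exprMn.
have chit v : chi (tens F v) = \prod_(x <- v) hdot eta x.
  elim: v => [|x v IH]; first by rewrite big_nil chi1.
  by rewrite big_cons -heta -IH -chicat.
(* The partial sum [g] at [eta] has [chi g = S] and [|g|^2 = S]; thus [S^2 <= M^2 S], and
   [S <= M^2]. *)
have sumle n : \sum_(0 <= k < n) w k ^- 2 * rnorm eta ^+ (2 * k) <= M ^+ 2.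
  set S := \sum_(_ <= _ < _) _.
  have S0 : 0 <= S by apply: sumr_ge0 => k _; apply: weight_term_ge0.
  pose g := series (kernel_term eta) n.
  have ng : rnorm g ^+ 2 = S.
    have := @rnorm_kernel_sum (fun=> 1) eta 0%N n.
    under eq_bigr => k _ do rewrite scale1r.
    under [in X in _ = X -> _]eq_bigr => k _ do rewrite /cabs normr1 expr1n mul1r.
    by [].
  have cg : chi g = S%:C%C.
    rewrite hxi /g /series /= hdot_sumr rmorph_sum /=; apply: eq_bigr => k _.
    rewrite hdotZr -hxi chit big_nseq iter_mulr_1 hdotxxE -rmorphXn -rmorphM /=.
    by rewrite exprM.
  have Mg : S <= M * rnorm g.
    by have := hM g; rewrite cg cabs_real ger0_norm.
  have : S ^+ 2 <= M ^+ 2 * S.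
    by rewrite -ng -exprMn; apply: lerXn2r; rewrite ?nnegrE ?ng // (le_trans S0).
  have [->|Sn0] := eqVneq S 0; first by rewrite sqr_ge0.
  by rewrite expr2 ler_pM2r // lt_neqAle eq_sym Sn0.
have eB : in_ball w eta.
  apply: ereal_sup_ubound; exists (rnorm eta) => //; split; first exact: rnorm_ge0.
  apply: nondecreasing_is_cvgn.
    apply/nondecreasing_seqP => n; rewrite /series /= big_nat_recr //= lerDl.
    exact: weight_term_ge0.
  by exists (M ^+ 2) => _ [n _ <-]; apply: sumle.
exists eta => // f; apply/eqP; rewrite -subr_eq0 hxi -hdotBl; apply/eqP.
apply: (@fock_eq0 _ _ _ F (hdot (xi - kernel_vector F eta)) (rnorm (xi - kernel_vector F eta))).
- by move=> a x y; rewrite hdotDr hdotZr.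
- by move=> x; apply: cauchy_schwarz.
- by move=> u; rewrite hdotBl -hxi chit hdot_kernel_tens // subrr.
Qed.

End KernelVectors.

(** Inclusion-exclusion: the sets containing all entries of [t] cancel in pairs unless [t] exhausts
    the index set, which leaves only the full set. *)
Lemma sum_sign_supersets (K : numFieldType) (n : nat) (t : seq 'I_n) :
  \sum_(A : {set 'I_n} | all (mem A) t) (-1) ^+ #|A| =
  if [forall i, i \in t] then (-1) ^+ n else 0 :> K.
Proof.
case: forallP => [tT|/forallP].
  rewrite (big_pred1 [set: 'I_n]%SET) ?cardsT ?card_ord // => A /=.
  apply/allP/eqP => [tA|-> i _]; last exact: finset.in_setT.
  by apply/finset.setP => i; rewrite finset.inE; apply: tA.
rewrite negb_forall => /existsP[i0 i0t].
(* toggling the membership of i0 flips the sign and preserves the condition *)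
pose h (A : {set 'I_n}) := if i0 \in A then A :\ i0 else i0 |: A.
have hK : involutive h.
  move=> A; rewrite /h; have [i0A|i0A] := boolP (i0 \in A).
    by rewrite !finset.inE eqxx /= finset.setD1K.
  by rewrite !finset.inE eqxx /= finset.setU1K.
set S := \sum_(A | _) _.
have SN : S = - S.
  rewrite {1}/S (reindex_inj (inv_inj hK)) /= -sumrN; apply: eq_big => [A|A _].
    apply: eq_in_all => i it; rewrite /h.
    have ne : i != i0 by apply: contraNneq i0t => <-.
    by case: ifP => _; rewrite !finset.inE ?ne // (negbTE ne).
  rewrite /h; case: ifP => i0A.
    by rewrite [in RHS](cardsD1 i0) i0A exprS mulN1r opprK.
  by rewrite cardsU1 i0A exprS mulN1r.
have : S + S = 0 by rewrite {1}SN addNr.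
by rewrite -mulr2n => /eqP; rewrite mulrn_eq0 /= => /eqP.
Qed.

(** * The kernel space is the symmetric Fock space *)

Section Polarization.
Variables (R : realType) (H : hilbertType R) (w : nat -> R) (F : fock_space H w).

(** Multilinear expansion, one factor at a time; the prefix [a] holds the vectors already chosen. *)
Lemma tens_power_sum (n : nat) (x : 'I_n -> H) (A : {set 'I_n}) m (a : seq H) :
  tens F (a ++ nseq m (\sum_(i in A) x i)) =
  \sum_(t : m.-tuple 'I_n | all (mem A) t) tens F (a ++ map x t).
Proof.
elim: m a => [|m IH] a.
  by rewrite (big_pred1 [tuple]) // => t; rewrite tuple0; apply/esym/eqP.
rewrite /= tens_sum.
under [LHS]eq_bigr => i _ do rewrite -cat_rcons IH.
rewrite pair_big_dep /=.
rewrite [RHS](reindex (fun p : 'I_n * m.-tuple 'I_n => [tuple of p.1 :: p.2])) /=; last first.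
  exists (fun t : m.+1.-tuple 'I_n => (thead t, [tuple of behead t])) => [p _|t _] /=.
    by case: p => i t; congr (_, _); apply: val_inj.
  by rewrite -tuple_eta.
by apply: eq_big => [[i t]|[i t] _] //=; rewrite cat_rcons.
Qed.

(** A tuple of length [n] that meets every index has no repetition, so it lists the values of a
    permutation. *)
Lemma sum_surjective_tuples n (x : 'I_n -> H) :
  \sum_(t : n.-tuple 'I_n | [forall i, i \in t]) tens F (map x t) =
  \sum_(s : {perm 'I_n}) tens F [seq x (s i) | i <- enum 'I_n].
Proof.
pose h (s : {perm 'I_n}) := [tuple of [seq s i | i <- ord_tuple n]].
have hE s : val (h s) = [seq s i | i <- enum 'I_n] by [].
have hinj : injective h.
  move=> s s' /(congr1 val); rewrite !hE => /eq_in_map E.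
  by apply/permP => i; apply: E; rewrite mem_enum.
rewrite (reindex_onto h (fun t => odflt 1%g [pick s | h s == t])) /=; last first.
  move=> t /forallP tT; case: pickP => [s /eqP //|noS].
  have ut : uniq t.
    apply: (leq_size_uniq (enum_uniq 'I_n)) => [i _|]; first exact: tT.
    by rewrite size_tuple size_enum_ord.
  move/tuple_uniqP: ut => ut; have := noS (perm ut); rewrite -val_eqE hE.
  suff -> : [seq perm ut i | i <- enum 'I_n] = t by rewrite eqxx.
  rewrite -[RHS]map_tnth_enum.
  by apply: eq_map => i; rewrite permE.
apply: eq_big => [s|s _]; last by rewrite -map_comp.
case: pickP => [s' /eqP/hinj -> /=|/(_ s)]; last by rewrite eqxx.
rewrite eqxx andbT; apply/forallP => i.
by apply/mapP; exists ((s^-1)%g i); rewrite ?mem_enum ?permKV.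
Qed.

(** Once the powers are expanded, summing the signs over subsets first leaves only the surjective
    tuples, that is, the permutations. *)
Lemma polarization (u : seq H) :
  \sum_(A : {set 'I_(size u)}) (-1) ^+ #|A| *:
     tens F (nseq (size u) (\sum_(i in A) tnth (in_tuple u) i)) =
  ((-1) ^+ size u * (size u)`!%:R) *: symtens F u.
Proof.
set n := size u; set x := tnth (in_tuple u).
under eq_bigr => A _ do rewrite (tens_power_sum x A n [::]) scaler_sumr.
rewrite (exchange_big_dep xpredT) //=.
under eq_bigr => t _ do rewrite -scaler_suml sum_sign_supersets.
rewrite /symtens scalerA -mulrA divff ?mulr1 ?pnatr_eq0 -?lt0n ?fact_gt0 //.
rewrite -sum_surjective_tuples scaler_sumr big_mkcond [RHS]big_mkcond /=.
by apply: eq_bigr => t _; case: ifP => // _; rewrite ?scale0r.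
Qed.

Lemma symtens_sub (S : set F) : linear_subspace S ->
  (forall n eta, S (tens F (nseq n eta))) -> forall u, S (symtens F u).
Proof.
move=> lS Sn u.
have cn0 : (-1) ^+ size u * (size u)`!%:R != 0 :> R[i].
  by rewrite mulf_neq0 ?signr_eq0 // pnatr_eq0 -lt0n fact_gt0.
rewrite -[symtens F u](scalerK cn0) -polarization.
apply: subspaceZ => //; apply: subspace_sum => // A _.
exact: subspaceZ.
Qed.

Lemma symtens_nseq n eta : symtens F (nseq n eta) = tens F (nseq n eta).
Proof.
rewrite /symtens; under eq_bigr => s _.
  rewrite (_ : map _ _ = nseq n eta); first over.
  apply: (@eq_from_nth _ 0) => [|i]; rewrite size_map size_enum_ord ?size_nseq //.
  move=> ilt; rewrite (nth_map (Ordinal ilt)) ?size_enum_ord //.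
  case: (s _) => j jlt; rewrite (tnth_nth 0) /= !nth_nseq.
  have -> : (j < n)%N by rewrite -[n in (_ < n)%N](size_nseq n eta).
  by have -> : (i < n)%N by rewrite -[n in (_ < n)%N](size_nseq n eta).
rewrite sumr_const card_Sn -(scaler_nat _ (tens F (nseq n eta))) scalerA.
rewrite size_nseq mulVf ?scale1r //.
Qed.

End Polarization.

Section KernelSpace.
Variables (R : realType) (H : hilbertType R) (w : nat -> R) (F : fock_space H w).
Hypothesis w_gt0 : forall n, 0 < w n.
Hypothesis w_l2 : square_summable (fun n => (w n)^-1).
Hypothesis w_sub : subconvolutive (fun n => w n ^- 2).

Lemma in_ballZ a (eta : H) : cabs a <= 1 -> in_ball w eta -> in_ball w (a *: eta).
Proof.
move=> a1; apply: le_trans; rewrite lee_fin !hnormE rnormZ.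
by rewrite -[leRHS]mul1r ler_wpM2r ?rnorm_ge0.
Qed.

(** Square-summability of [w^-1] is convergence of the power series at 1, so the radius is at least
    1. *)
Lemma in_ball1 (eta : H) : rnorm eta <= 1 -> in_ball w eta.
Proof.
move=> e1; apply: (@le_trans _ _ 1%:E); first by rewrite lee_fin.
apply: ereal_sup_ubound; exists 1 => //; split=> //.
suff -> : (fun n => w n ^- 2 * 1 ^+ (2 * n)) = (fun n => (w n)^-1 ^+ 2) by [].
by apply/funext => n; rewrite expr1n mulr1 exprVn.
Qed.

(* The terms of degree n are the iterated difference quotients at t = 0 of the
   power series t |-> kernel_vector (t *: eta). *)
Lemma kernel_term_kernel_space (eta : H) n : in_ball w eta ->
  kernel_space F (kernel_term F eta n).
Proof.
move=> eB.
have lK : linear_subspace (kernel_space F) by apply: closed_span_subspace.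
have cK : closed (kernel_space F) by apply: closed_span_closed.
elim/ltn_ind: n => n IH; apply: cK; apply/closure_rnormP => e e0.
have [C hC] := ball_sum_le w_gt0 w_sub eB.
have C0 : 0 <= C by have := hC 0%N 0%N; rewrite big_geq.
have p0 : 0 < Num.sqrt C + 1 by rewrite ltr_wpDl ?sqrtr_ge0.
(* The final error is at most [t * sqrt C]; [t <= 1] keeps [t *: eta] in the ball and the powers of
   [t] nonincreasing. *)
pose t := Num.min 1 (e / 2 / (Num.sqrt C + 1)).
have t0 : 0 < t by rewrite lt_min ltr01 !divr_gt0.
have t1 : t <= 1 by rewrite ge_min lexx.
have te : t * Num.sqrt C < e.
  have : t * (Num.sqrt C + 1) <= e / 2 by rewrite -ler_pdivlMr // ge_min lexx orbT.
  lra.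
have tC0 : t%:C%C != 0 :> R[i] by rewrite fmorph_eq0 gt_eqF.
have ct : cabs t%:C%C = t by rewrite cabs_real gtr0_norm.
have tB : in_ball w (t%:C%C *: eta) by apply: in_ballZ; rewrite ?ct.
pose s := \sum_(0 <= k < n) t%:C%C ^+ k *: kernel_term F eta k.
(* The terms of lower degree, which lie in the space by induction, are removed from the kernel
   vector at [t *: eta], and degree [n] is normalized. *)
exists ((t%:C%C ^+ n)^-1 *: (kernel_vector F (t%:C%C *: eta) - s)).
  apply: (subspaceZ _ lK); apply: (subspaceB lK).
    by apply: mem_closed_span; exists (t%:C%C *: eta).
  rewrite /s big_mkord; apply: (subspace_sum _ lK) => k _; apply: (subspaceZ _ lK).
  exact: IH.
(* The remaining terms are orthogonal, have degree above [n] and carry a factor at most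
   [t ^+ n.+1]. *)
have bound : rnorm (kernel_vector F (t%:C%C *: eta)
    - \sum_(0 <= k < n.+1) t%:C%C ^+ k *: kernel_term F eta k) <= t ^+ n.+1 * Num.sqrt C.
  apply: (rnorm_lim_le (ball_cvg w_gt0 w_sub tB)); exists n.+1 => m nm.
  rewrite /series /= (@big_cat_nat _ _ _ n.+1) //=.
  under eq_bigr => k _ do rewrite kernel_termZ.
  rewrite [X in X - _]addrC addrK.
  under eq_bigr => k _ do rewrite kernel_termZ.
  rewrite -(@ler_pXn2r _ 2) ?nnegrE ?mulr_ge0 ?rnorm_ge0 ?sqrtr_ge0 ?exprn_ge0 ?(ltW t0) //.
  rewrite rnorm_kernel_sum // exprMn sqr_sqrtr //.
  apply: (@le_trans _ _ (\sum_(n.+1 <= k < m)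
      (t ^+ n.+1) ^+ 2 * (w k ^- 2 * rnorm eta ^+ (2 * k)))); last first.
    by rewrite -mulr_sumr ler_wpM2l // ?sqr_ge0 // hC.
  apply: ler_sum_nat => k /andP[nk _]; apply: ler_wpM2r; first exact: weight_term_ge0.
  rewrite cabsX ct; apply: lerXn2r; rewrite ?nnegrE ?exprn_ge0 ?(ltW t0) //.
  by apply: ler_wiXn2l; rewrite ?(ltW t0).
move: bound; rewrite big_nat_recr //= -/s.
set K := kernel_vector _ _; set v := kernel_term _ _ _ => bound.
have -> : v - (t%:C%C ^+ n)^-1 *: (K - s) =
    - (t%:C%C ^+ n)^-1 *: (K - (s + t%:C%C ^+ n *: v)).
  rewrite opprD addrA [in RHS]scalerDr scalerN scalerA mulNr mulVf ?expf_neq0 //.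
  by rewrite !scaleNr scale1r opprK [LHS]addrC.
rewrite rnormZ cabsN cabsV cabsX ct; apply: le_lt_trans te.
rewrite mulrC ler_pdivrMr ?exprn_gt0 //; apply: (le_trans bound).
by rewrite exprS mulrAC.
Qed.

(** Kernel vectors are limits of combinations of powers, which are symmetric; conversely all powers
    lie in the kernel space, and polarization yields the symmetric tensors. *)
Lemma kernel_space_sym_fock : kernel_space F = sym_fock F.
Proof.
have lS : linear_subspace (sym_fock F) by apply: closed_span_subspace.
have lK : linear_subspace (kernel_space F) by apply: closed_span_subspace.
have cS : closed (sym_fock F) by apply: closed_span_closed.
have cK : closed (kernel_space F) by apply: closed_span_closed.
apply/seteqP; split; apply: closed_span_sub => //.
  move=> _ [eta eB <-].
  apply: (closed_lim cS _ (ball_cvg w_gt0 w_sub eB)) => n.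
  rewrite /series /= big_mkord; apply: (subspace_sum _ lS) => k _; apply: (subspaceZ _ lS).
  by apply: mem_closed_span; exists (nseq k eta) => //; apply: symtens_nseq.
move=> _ [u _ <-]; apply: (symtens_sub lK) => n eta.
(* Vectors of norm at most 1 lie in the ball of convergence; the others follow by homogeneity. *)
have small (x : H) : rnorm x <= 1 -> kernel_space F (tens F (nseq n x)).
  move=> /in_ball1 xB; have := kernel_term_kernel_space (n := n) xB.
  rewrite /kernel_term => Kx.
  have wn : (w n ^- 2)%:C%C != 0 :> R[i] by rewrite fmorph_eq0 gt_eqF // inv_weight_gt0.
  by rewrite -[tens F _](scalerK wn); apply: (subspaceZ _ lK).
have [->|eta0] := eqVneq eta 0; first by apply: small; rewrite rnorm0.
have r0 : rnorm eta != 0 by apply: contra eta0 => /eqP/rnorm_eq0 ->.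
have rC0 : (rnorm eta)%:C%C != 0 :> R[i] by rewrite fmorph_eq0.
rewrite -[eta](scalerKV rC0) (tens_nseqZ F [::]); apply: (subspaceZ _ lK).
by apply: small; rewrite rnormZ cabsV cabs_real ger0_norm ?rnorm_ge0 // mulVf.
Qed.

End KernelSpace.

Lemma closed_span_orth (R : realType) (H : hilbertType R) (A : set H) (f : H) :
  (forall a, A a -> hdot a f = 0) -> forall g, closed_span A g -> hdot g f = 0.
Proof.
move=> Af; apply: (@closed_span_sub _ _ A [set g | hdot g f = 0]) => //.
  split=> [|a x y]; first exact: hdot0l.
  by rewrite /= hdotDl hdotZl => -> ->; rewrite mulr0 addr0.
apply: closed_rnormP => x hx; apply: small_cabs_eq0 => e e0.
have p0 : 0 < rnorm f + 1 by rewrite ltr_wpDl ?rnorm_ge0.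
have [|a /= af xa] := hx (e / (rnorm f + 1)); first by rewrite divr_gt0.
have -> : hdot x f = hdot (x - a) f by rewrite hdotBl af subr0.
move: xa; rewrite ltr_pdivlMr //; apply: le_lt_trans.
by rewrite (le_trans (cauchy_schwarz _ _))// ler_wpM2l ?rnorm_ge0// lerDl.
Qed.

(** * The quotient by the joint kernel of the characters *)

Section Main.
Variables (R : realType) (H : hilbertType R) (w : nat -> R) (F : fock_space H w).
Hypothesis w_gt0 : forall n, 0 < w n.
Hypothesis w_l2 : square_summable (fun n => (w n)^-1).
Hypothesis w_sub : subconvolutive (fun n => w n ^- 2).

Local Notation S := (sym_fock F).
Local Notation P := (sym_proj F).
Local Notation J := (spectral_radical F).

Lemma sym_fock_subspace : linear_subspace S.
Proof. exact: closed_span_subspace. Qed.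

Lemma sym_fock_closed : closed S.
Proof. exact: closed_span_closed. Qed.

Let lS := sym_fock_subspace.
Let cS := sym_fock_closed.

Lemma sym_projP f : S (P f).
Proof. exact: (orth_projP lS cS f).1. Qed.

(** The characters are exactly the pairings with kernel vectors, whose closed span is [S]. *)
Lemma spectral_radicalP f : J f <-> forall g, S g -> hdot g f = 0.
Proof.
rewrite -(kernel_space_sym_fock F w_gt0 w_l2 w_sub); split=> [Jf|Kf].
  apply: closed_span_orth => _ [eta eB <-].
  exact: (Jf _ (@kernel_spectrum R H w F w_gt0 w_sub eta eB)).
move=> chi hchi /=; have [eta eB ->] := character_kernel w_gt0 w_sub hchi.
by apply: Kf; apply: mem_closed_span; exists eta.
Qed.

Lemma sym_proj_eq0 f : P f = 0 <-> J f.
Proof.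
rewrite spectral_radicalP; split=> [Pf g Sg|]; last exact: (orth_proj_eq0 lS cS).
by rewrite -(hdot_orth_proj lS cS f Sg) -/(P f) Pf hdot0r.
Qed.

Lemma sym_proj_linear a x y : P (a *: x + y) = a *: P x + P y.
Proof. exact: orth_proj_linear. Qed.

Lemma sym_proj_id f : S f -> P f = f.
Proof. exact: orth_proj_id. Qed.

Lemma sym_projD x y : P (x + y) = P x + P y.
Proof. by have := sym_proj_linear 1 x y; rewrite !scale1r. Qed.

Lemma sym_projB x y : P (x - y) = P x - P y.
Proof. by rewrite addrC -scaleN1r sym_proj_linear scaleN1r addrC. Qed.

Lemma spectral_radical_subspace : linear_subspace J.
Proof.
split=> [|a x y /sym_proj_eq0 Px /sym_proj_eq0 Py].
  by apply/spectral_radicalP => g _; apply: hdot0r.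
by apply/sym_proj_eq0; rewrite sym_proj_linear Px Py scaler0 addr0.
Qed.

Let lJ := spectral_radical_subspace.

Lemma spectral_radical_proj f : J (f - P f).
Proof. by apply/sym_proj_eq0; rewrite sym_projB (sym_proj_id (@sym_projP f)) subrr. Qed.

Lemma spectral_radical_ideal f g : J f \/ J g -> J (ftens F f g).
Proof.
move=> Jfg chi hchi /=; have [_ _ chiM _] := hchi; rewrite chiM //.
by case: Jfg => /(_ _ hchi) /= ->; rewrite ?mul0r ?mulr0.
Qed.

Lemma ftens_congr f f' g g' : J (f - f') -> J (g - g') ->
  J (ftens F f g - ftens F f' g').
Proof.
move=> Jf Jg.
have -> : ftens F f g - ftens F f' g' = ftens F (f - f') g + ftens F f' (g - g').
  have -> : ftens F (f - f') g = ftens F f g - ftens F f' g.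
    by rewrite addrC -scaleN1r ftensDl // scaleN1r addrC.
  have -> : ftens F f' (g - g') = ftens F f' g - ftens F f' g'.
    by rewrite addrC -scaleN1r ftensDr // scaleN1r addrC.
  by rewrite addrA subrK.
by apply: (subspaceD lJ); apply: spectral_radical_ideal; [left|right].
Qed.

(** Projecting changes each factor by an element of the ideal [J], on which [P] vanishes. This makes
    [P] multiplicative onto [S]. *)
Lemma sym_proj_ftens f g : P (ftens F f g) = P (ftens F (P f) (P g)).
Proof.
apply/eqP; rewrite -subr_eq0 -sym_projB; apply/eqP/sym_proj_eq0.
by apply: ftens_congr; apply: spectral_radical_proj.
Qed.

Lemma mem_coset f a : coset J f a <-> J (a - f).
Proof.
split=> [[j Jj <-]|Ja]; first by rewrite addrC addKr.
by exists (a - f) => //; rewrite addrC subrK.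
Qed.

Lemma coset_id f : coset J f f.
Proof. by apply/mem_coset; rewrite subrr; case: lJ. Qed.

Lemma mem_coset_proj f a : coset J f a <-> P a = P f.
Proof.
by rewrite mem_coset -sym_proj_eq0 sym_projB; split=> [/subr0_eq //|->]; rewrite subrr.
Qed.

Lemma coset_add f g :
  [set a + b | a in coset J f & b in coset J g] = coset J (f + g).
Proof.
apply/seteqP; split=> x.
  move=> [a /mem_coset_proj Pa [b /mem_coset_proj Pb <-]].
  by apply/mem_coset_proj; rewrite !sym_projD Pa Pb.
move=> /mem_coset Jx; exists f; first exact: coset_id.
exists (x - f); last by rewrite addrC subrK.
by apply/mem_coset; rewrite -addrA -opprD.
Qed.

Lemma coset_scale c f :
  [set c *: a + j | a in coset J f & j in J] = coset J (c *: f).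
Proof.
apply/seteqP; split=> x.
  move=> [a /mem_coset_proj Pa [j /sym_proj_eq0 Pj <-]]; apply/mem_coset_proj.
  by rewrite sym_proj_linear Pj -[c *: f]addr0 sym_proj_linear Pa (sym_proj_eq0 0).2 //; case: lJ.
move=> /mem_coset Jx; exists f; first exact: coset_id.
by exists (x - c *: f) => //; rewrite addrC subrK.
Qed.

(** The products of representatives lie in a single coset because [J] is an ideal, but need not fill
    it; adding [J] does. *)
Lemma coset_mul f g :
  [set ftens F ab.1 ab.2 + j | ab in coset J f `*` coset J g & j in J] =
  coset J (ftens F f g).
Proof.
apply/seteqP; split=> x.
  move=> [[a b] [/= /mem_coset Ja /mem_coset Jb] [j Jj <-]]; apply/mem_coset.
  by rewrite addrAC; apply: (subspaceD lJ) => //; apply: ftens_congr.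
move=> /mem_coset Jx; exists (f, g); first by split; apply: coset_id.
by exists (x - ftens F f g) => //; rewrite addrC subrK.
Qed.

(** [P f] belongs to the coset and is the projection of each of its elements, so it has the least
    norm. *)
Lemma quotient_norm f : inf [set hnorm a | a in coset J f] = rnorm (P f).
Proof.
have PJ : coset J f (P f) by apply/mem_coset_proj; rewrite sym_proj_id //; apply: sym_projP.
apply/eqP; rewrite eq_le; apply/andP; split.
  by apply: ge_inf; [exists 0 => _ [a _ <-]; apply: rnorm_ge0 | exists (P f)].
apply: lb_le_inf; first by exists (rnorm (P f)), (P f).
by move=> _ [a /mem_coset_proj <- <-]; apply: (rnorm_orth_proj_le lS cS).
Qed.

(** The representative taken by [xget] is immaterial, since [P] is constant on cosets of [J]. *)
Definition quotient_proj (A : set F) : F := P (xget 0 A).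

Lemma quotient_proj_coset f : quotient_proj (coset J f) = P f.
Proof.
rewrite /quotient_proj; case: xgetP => [x -> /mem_coset_proj //|/(_ f)].
by have := coset_id f.
Qed.

Lemma fock_unit_sym : S (fock_unit F).
Proof. by apply: mem_closed_span; exists [::] => //; apply: (symtens_nseq F 0 0). Qed.

Lemma mul_closed_sym : mul_closed (sym_algebra S).
Proof. by split=> [|x y _ _]; [apply: fock_unit_sym | apply: sym_projP]. Qed.

(** The projection sends each coset to its element of least norm, so it is isometric and the Banach
    bound holds with constant 1. *)
Lemma quotient_iso :
  isomorphic (quotient_algebra J) (sym_algebra (kernel_space F)).
Proof.
rewrite kernel_space_sym_fock //.
have lin : @linear_iso R (quotient_algebra J) (sym_algebra S) quotient_proj.
  split=> /=.
  - split.
    + by move=> _ [f _ <-] /=; rewrite quotient_proj_coset; apply: sym_projP.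
    + move=> _ _ /set_mem[f _ <-] /set_mem[g _ <-]; rewrite !quotient_proj_coset => Pfg.
      by apply/seteqP; split=> x /mem_coset_proj Px; apply/mem_coset_proj; rewrite Px.
    + by move=> f Sf; exists (coset J f); [exists f | rewrite quotient_proj_coset sym_proj_id].
  - by move=> _ _ [f _ <-] [g _ <-]; rewrite coset_add !quotient_proj_coset sym_projD.
  - move=> a _ [f _ <-]; rewrite coset_scale !quotient_proj_coset.
    by rewrite -[a *: f]addr0 sym_proj_linear (sym_proj_eq0 0).2 ?addr0 //; case: lJ.
have norm : forall x, ha_dom (h := quotient_algebra J) x ->
    rnorm (quotient_proj x) = ha_norm (h := quotient_algebra J) x.
  by move=> _ [f _ <-]; rewrite /= quotient_norm quotient_proj_coset.
exists quotient_proj; split; first by split.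
split=> //.
- split; first by exists (fock_unit F).
  by move=> _ _ [f _ <-] [g _ <-]; rewrite /= coset_mul; exists (ftens F f g).
- exact: mul_closed_sym.
- split=> [_ _ [f _ <-] [g _ <-]|] /=; last first.
    by rewrite quotient_proj_coset sym_proj_id //; apply: fock_unit_sym.
  by rewrite coset_mul !quotient_proj_coset sym_proj_ftens.
- by exists 1 => x dx; rewrite !mul1r -norm //= hnormE.
Qed.

(** Both carriers are the same subset, so the identity serves. *)
Lemma sym_iso :
  isomorphic (sym_algebra (kernel_space F)) (sym_algebra (sym_fock F)).
Proof.
rewrite kernel_space_sym_fock //.
have lin : @linear_iso R (sym_algebra S) (sym_algebra S) id.
  by split=> //; split=> // x Sx; exists x.
exists id; split; first by split.
split=> //; try exact: mul_closed_sym.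
by exists 1 => x _; rewrite mul1r.
Qed.

(** For [xi] in [S] the pairings with [f] and [P f] agree, and [P] is multiplicative; conversely a
    vector representing a character of the full algebra is a kernel vector, hence in [S]. *)
Lemma same_spectra :
  [set xi : F | S xi /\ spectrum (sym_algebra S) (hdot xi)]
  = [set xi : F | spectrum (full_algebra F) (hdot xi)].
Proof.
apply/seteqP; split=> xi /=.
  move=> [Sxi [/= _ _ xiM [x Sx xi0]]]; split=> /=.
  - by move=> f g _ _; apply: hdotDr.
  - by move=> a f _; apply: hdotZr.
  - move=> f g _ _; rewrite -(hdot_orth_proj lS cS _ Sxi) -/(P _) sym_proj_ftens.
    rewrite xiM; try exact: sym_projP.
    by rewrite !(hdot_orth_proj lS cS _ Sxi).
  - by exists x.
move=> hxi; have [eta eB xiE] := character_kernel w_gt0 w_sub hxi.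
have Sxi : S xi.
  rewrite -kernel_space_sym_fock //; apply: mem_closed_span; exists eta => //.
  (* Two vectors representing the same functional have a difference orthogonal to itself. *)
  apply/esym/eqP; rewrite -subr_eq0; apply/eqP/rnorm_eq0/eqP.
  have := hdotxxE (xi - kernel_vector F eta); rewrite hdotBl xiE subrr => /eqP.
  by rewrite eq_sym fmorph_eq0 expf_eq0.
split=> //; have [_ _ xiM [x _ xi0]] := hxi; split=> /=.
- by move=> f g _ _; apply: hdotDr.
- by move=> a f _; apply: hdotZr.
- by move=> f g _ _; rewrite (hdot_orth_proj lS cS _ Sxi) xiM.
- exists (P x); first exact: sym_projP.
  by rewrite (hdot_orth_proj lS cS _ Sxi).
Qed.

End Main.

Theorem theorem9 (R : realType) (H : hilbertType R) (w : nat -> R)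
  (H_separable : separable H)
  (w_gt0 : forall n, 0 < w n)
  (w0 : w 0%N = 1)
  (w_l2 : square_summable (fun n => (w n)^-1))
  (w_subconv : subconvolutive (fun n => w n ^- 2))
  (F : fock_space H w) :
  [/\ is_tensor_product (ftens F),
      isomorphic (quotient_algebra (spectral_radical F))
                 (sym_algebra (kernel_space F)),
      isomorphic (sym_algebra (kernel_space F)) (sym_algebra (sym_fock F)) &
      [set xi : F | sym_fock F xi /\
                    spectrum (sym_algebra (sym_fock F)) (hdot xi)]
      = [set xi : F | spectrum (full_algebra F) (hdot xi)]].
Proof.
split; [exact: ftensP | exact: quotient_iso | exact: sym_iso | exact: same_spectra].
Qed.
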